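(* As $n\to\infty$, $$n-F_{2,3}(n)\sim n-f_{2,3}(n)\sim C_3\,n^{2/3},$$ where $$C_3=\frac{\pi^2}{4}\prod_p\left(1-\frac3{p^2}+\frac2{p^3}\right)=0.7075209\ldots,$$ the product being over all primes $p$.
   Context: Write $[n]=\{1,\dots,n\}$. $F_{2,3}(n)$ is the largest size of a set $A\subseteq[n]$ such that there are no two distinct elements $a,b\in A$ with $ab=x^3$ for some positive integer $x$; $f_{2,3}(n)$ is the largest size of a set $A\subseteq[n]$ such that there are no $a,b\in A$, not necessarily distinct, with $ab=x^3$ for some positive integer $x$. *)

(* Defs.v *)
From HB Require Import structures.
From mathcomp Require Import all_boot all_order all_algebra.
From mathcomp Require Import all_classical all_reals all_analysis.
From mathcomp Require Import ring lra.

Set Implicit Arguments.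
Unset Strict Implicit.
Unset Printing Implicit Defensive.

Import Order.TTheory GRing.Theory Num.Theory.
Import numFieldNormedType.Exports.

Local Open Scope ring_scope.

Definition positive_cube (m : nat) : Prop :=
  exists x : nat, (0 < x)%N /\ m = (x ^ 3)%N.

(* [n] = {1, ..., n}, inside 'I_n.+1 = {0, ..., n} *)
Definition segment (n : nat) : {set 'I_n.+1} := [set i : 'I_n.+1 | (0 < i)%N]%SET.

Definition no_distinct_cube_pair (n : nat) (A : {set 'I_n.+1}) : Prop :=
  forall a b : 'I_n.+1, a \in A -> b \in A -> a <> b -> ~ positive_cube (a * b)%N.

Definition no_cube_pair (n : nat) (A : {set 'I_n.+1}) : Prop :=
  forall a b : 'I_n.+1, a \in A -> b \in A -> ~ positive_cube (a * b)%N.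

(* The empty set is always admissible, so the maxima below are attained. *)
Definition F23 (n : nat) : nat :=
  (\max_(A : {set 'I_n.+1} | (A \subset segment n) && `[< no_distinct_cube_pair A >]) #|A|)%N.

Definition f23 (n : nat) : nat :=
  (\max_(A : {set 'I_n.+1} | (A \subset segment n) && `[< no_cube_pair A >]) #|A|)%N.

Definition euler_factor (R : realType) (p : nat) : R :=
  1 - 3 / p%:R ^+ 2 + 2 / p%:R ^+ 3.

Definition C3 (R : realType) : R :=
  pi ^+ 2 / 4 * \big[*%R/1]_(0 <= p <oo | prime p) euler_factor R p.

Lemma euler_factor_itv (R : realType) (p : nat) :
  prime p -> 0 <= euler_factor R p <= 1.
Proof.
move=> pp; have p2 : (2 <= p%:R :> R) by rewrite ler_nat prime_gt1.
have p0 : (0 < p%:R :> R) by apply: lt_le_trans p2.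
set x : R := p%:R^-1.
have xi : x * p%:R = 1 by rewrite mulVf // gt_eqF.
have x0 : 0 < x by rewrite invr_gt0.
have x1 : 2 * x <= 1 by rewrite /x ler_pdivrMr // mul1r.
have -> : euler_factor R p = (1 - x) ^+ 2 * (1 + 2 * x).
  by rewrite /euler_factor -!exprVn -/x; ring.
apply/andP; split; first by rewrite mulr_ge0 ?sqr_ge0 //; lra.
suff : 0 <= x ^+ 2 * (3 - 2 * x) by lra.
by rewrite mulr_ge0 ?sqr_ge0 //; lra.
Qed.

(* The partial products converge, so the limit in C3 is a genuine one
   rather than the default value of the total operator lim. *)
Lemma euler_product_cvg (R : realType) :
  cvgn (fun n => \prod_(0 <= p < n | prime p) euler_factor R p).
Proof.
have ge0 n : 0 <= \prod_(0 <= p < n | prime p) euler_factor R p.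
  by apply: prodr_ge0 => p /(euler_factor_itv R)/andP[].
apply: nonincreasing_is_cvgn; last by exists 0 => _ [n _ <-].
apply/nonincreasing_seqP => n.
rewrite [leLHS]big_mkcond big_nat_recr //= -big_mkcond /=.
case: ifP => [/(euler_factor_itv R)/andP[_ le1]|_]; last by rewrite mulr1.
by rewrite ler_piMr.
Qed.

(* Main.v *)
Require Import Defs.
From Stdlib Require Import NArith.
From HB Require Import structures.
From mathcomp Require Import all_boot all_order all_algebra.
From mathcomp Require Import all_classical all_reals all_analysis.
From mathcomp Require Import zify ring lra.

Set Implicit Arguments.
Unset Strict Implicit.
Unset Printing Implicit Defensive.

Import Order.TTheory GRing.Theory Num.Theory.
Import numFieldNormedType.Exports.

(** The product of a and b is a cube exactly when the classes of a and b in the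
    positive rationals modulo cubes are inverse to each other.  Each positive
    integer is uniquely x y^2 z^3 with x y squarefree, its class is the pair
    (x, y), and the inverse class is (y, x).  So the graph joining a and b when
    a b is a cube is a disjoint union of complete bipartite graphs between the
    classes (x, y) and (y, x), plus the clique of the cubes.  Inside [n], the
    class (x, y) with x < y is the smaller side, because x y^2 > y x^2.  A largest
    admissible set drops the smaller side of every bipartite piece and all the
    cubes, so that n - f(n) is the number T(n) of triples (x, y, z) with x <= y,
    x y squarefree and x y^2 z^3 <= n (f23E).  Allowing products of distinct
    elements only lets one cube back in, so F(n) is f(n) or f(n) + 1.

    To count the triples, fix z and put u = n^(1/3) / z.  The points (x, y) lie in
    the region x <= y, x y^2 <= u^3, whose area is 3/2 u^2.  The condition that
    x y be squarefree has density 1 - 3/p^2 + 2/p^3 at the prime p.  For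
    finitely many primes it is periodic, and a periodic condition is
    equidistributed in the region (region_sum_sieve); the pairs that a prime at
    least P excludes number O(u^2 / P) (sieve_excess).  Hence there are
    (3/2 D + o(1)) u^2 points, D being the Euler product
    (region_sum_squarefree).  Summing over z multiplies this by
    zeta(2) = pi^2/6 and gives T(n) ~ C3 n^(2/3) (smaller_triples_density).

    The value of zeta(2) is obtained from the duplication formula
    1/sin(t)^2 + 1/cos(t)^2 = 4/sin(2t)^2 (basel).

    For the decimals of C3, the Euler product converges too slowly to be summed
    directly.  One has 1 - 3/p^2 + 2/p^3 = (1 - 1/p^2)^3 (1 + t_p) with t_p of size
    2/p^3, so that C3 = 3/2 zeta(2)^(-2) times the product of the 1 + t_p.  The tail
    of that product is controlled by a telescoping bound
    (ratio_product_limit_bounds), the tail of zeta(2) likewise, and the finite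
    parts are evaluated in fixed-point integer arithmetic. *)

(** * Cubes, classes modulo cubes, and the extremal problem *)

Section CubicDecomposition.

Local Open Scope nat_scope.

(** Squarefreeness tested on the primes below P only: this truncated condition is
    periodic in m, which squarefreeness itself is not. *)
Definition sqfree_below (P m : nat) : bool :=
  all (fun p => ~~ (p ^ 2 %| m)) [seq p <- iota 0 P | prime p].

Definition squarefree (m : nat) : bool := sqfree_below m.+1 m.

Lemma sqfree_belowP P m :
  reflect (forall p, prime p -> p < P -> ~~ (p ^ 2 %| m)) (sqfree_below P m).
Proof.
apply: (iffP allP) => h p.
  by move=> pp pP; apply: h; rewrite mem_filter pp mem_iota.
by rewrite mem_filter mem_iota => /andP[pp /andP[_ pP]]; apply: h.
Qed.

Lemma squarefreeP m : 0 < m ->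
  reflect (forall p, prime p -> ~~ (p ^ 2 %| m)) (squarefree m).
Proof.
move=> m0; apply: (iffP (sqfree_belowP _ _)) => h p pp; last by move=> _; apply: h.
have [pm|mp] := ltnP p m.+1; first exact: h.
apply/negP => /dvdn_leq-/(_ m0) h2; have := prime_gt1 pp; nia.
Qed.

Lemma squarefree_logn m p : 0 < m -> squarefree m -> prime p -> logn p m <= 1.
Proof.
move=> m0 /(squarefreeP m0) h pp; have := h p pp.
by rewrite pfactor_dvdn // -ltnNge ltnS.
Qed.

(** Multiply the primes of m in one at a time.  A prime p that divides neither x
    nor y joins x; if it divides x it moves from x to y; if it divides y it leaves
    y and joins z.  So the exponent of p runs through 0, 1, 2 modulo 3. *)
Lemma cubic_decomposition m : 0 < m -> exists x y z,
  [/\ 0 < x, 0 < y, 0 < z, squarefree (x * y) & m = x * y ^ 2 * z ^ 3].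
Proof.
elim/ltn_ind: m => m IH m0.
have [m1|m1] := leqP m 1.
  by exists 1, 1, 1; have -> : m = 1 by lia.
have pp := pdiv_prime m1; set p := pdiv m in pp.
have p0 := prime_gt0 pp; have p1 := prime_gt1 pp.
have /dvdnP[k mE] : p %| m by apply: pdiv_dvd.
have k0 : 0 < k by case: k mE; lia.
have [|x [y [z [x0 y0 z0 sxy kE]]]] := IH k _ k0; first by nia.
have xy0 : 0 < x * y by rewrite muln_gt0 x0.
case: (boolP (p %| x)) => [/dvdnP[x' xE]|px].
  exists x', (y * p), z; split=> //; [nia|nia| |nia].
  by have -> : x' * (y * p) = x * y by rewrite xE; lia.
case: (boolP (p %| y)) => [/dvdnP[y' yE]|py].
  have xy'0 : 0 < x * y' by nia.
  exists x, y', (z * p); split=> //; [nia|nia| |nia].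
  apply/(squarefreeP xy'0) => q qp; have /(squarefreeP xy0)/(_ q qp) := sxy.
  by apply: contra => h; rewrite yE mulnA dvdn_mulr.
have pxy0 : 0 < p * x * y by rewrite -mulnA muln_gt0 p0.
exists (p * x), y, z; split=> //; [nia| |nia].
apply/(squarefreeP pxy0) => q qp; rewrite pfactor_dvdn // -mulnA lognM //.
rewrite logn_prime // -ltnNge; case: eqP => [->|_].
  by rewrite lognE pp xy0 /= Euclid_dvdM // (negPf px) (negPf py).
by rewrite add0n ltnS squarefree_logn.
Qed.

Lemma logn_composite p m : ~~ prime p -> logn p m = 0.
Proof. by rewrite lognE => /negPf->. Qed.

Lemma logn_cubic p x y z : 0 < x -> 0 < y -> 0 < z ->
  logn p (x * y ^ 2 * z ^ 3) = logn p x + 2 * logn p y + 3 * logn p z.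
Proof. by move=> *; rewrite !lognM ?lognX ?muln_gt0 ?expn_gt0 ?x0 //; lia. Qed.

(** For each prime the exponents of x and y are at most 1 in total, so that they
    are read off the exponent of p in x y^2 z^3 modulo 3. *)
Lemma cubic_decomposition_uniq x y z x' y' z' :
  0 < x -> 0 < y -> 0 < z -> 0 < x' -> 0 < y' -> 0 < z' ->
  squarefree (x * y) -> squarefree (x' * y') ->
  x * y ^ 2 * z ^ 3 = x' * y' ^ 2 * z' ^ 3 ->
  [/\ x = x', y = y' & z = z'].
Proof.
move=> x0 y0 z0 x'0 y'0 z'0 sxy sxy' e.
have xy0 : 0 < x * y by rewrite muln_gt0 x0.
have xy'0 : 0 < x' * y' by rewrite muln_gt0 x'0.
have key p : [/\ logn p x = logn p x', logn p y = logn p y'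
               & logn p z = logn p z'].
  case: (boolP (prime p)) => [pp|np]; last by rewrite !(logn_composite _ np).
  have := squarefree_logn xy0 sxy pp; rewrite lognM // => h.
  have := squarefree_logn xy'0 sxy' pp; rewrite lognM // => h'.
  have := congr1 (logn p) e; rewrite !logn_cubic // => h''.
  by move: h h' h''; clear; split; lia.
by split; apply: eqn_from_log => // p; have [] := key p.
Qed.

(** Modulo 3, the exponents of p in the two factors must be opposite. *)
Lemma cube_pair_swap x y z x' y' z' :
  0 < x -> 0 < y -> 0 < z -> 0 < x' -> 0 < y' -> 0 < z' ->
  squarefree (x * y) -> squarefree (x' * y') ->
  positive_cube (x * y ^ 2 * z ^ 3 * (x' * y' ^ 2 * z' ^ 3)) ->
  x' = y /\ y' = x.
Proof.
move=> x0 y0 z0 x'0 y'0 z'0 sxy sxy' [w [w0 e]].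
have xy0 : 0 < x * y by rewrite muln_gt0 x0.
have xy'0 : 0 < x' * y' by rewrite muln_gt0 x'0.
have key p : logn p x' = logn p y /\ logn p y' = logn p x.
  case: (boolP (prime p)) => [pp|np]; last by rewrite !(logn_composite _ np).
  have := squarefree_logn xy0 sxy pp; rewrite lognM // => h.
  have := squarefree_logn xy'0 sxy' pp; rewrite lognM // => h'.
  have := congr1 (logn p) e.
  rewrite lognM ?muln_gt0 ?expn_gt0 ?x0 ?y0 ?z0 ?x'0 ?y'0 ?z'0 //.
  by rewrite !logn_cubic // lognX => h''; move: h h' h''; clear; split; lia.
by split; apply: eqn_from_log => // p; have [] := key p.
Qed.

Lemma cube_pair_partner x y z : 0 < x -> 0 < y -> 0 < z ->
  positive_cube (x * y ^ 2 * z ^ 3 * (y * x ^ 2 * z ^ 3)).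
Proof.
move=> x0 y0 z0; exists (x * y * z ^ 2).
by rewrite !(muln_gt0, expn_gt0) x0 y0 z0; split=> //; rewrite !expnMn; lia.
Qed.

(** Triples (x, y, z) indexing the elements x y^2 z^3 of [n] whose class is the
    smaller one of its pair of inverse classes, or is the class of the cubes. *)
Definition smaller_triples (n : nat) : {set 'I_n.+1 * 'I_n.+1 * 'I_n.+1} :=
  [set t : 'I_n.+1 * 'I_n.+1 * 'I_n.+1 |
    [&& 0 < t.1.1, t.1.1 <= t.1.2, 0 < t.2, squarefree (t.1.1 * t.1.2)
      & t.1.1 * t.1.2 ^ 2 * t.2 ^ 3 <= n]]%SET.

Lemma smaller_triplesP n (t : 'I_n.+1 * 'I_n.+1 * 'I_n.+1) :
  reflect [/\ 0 < t.1.1, t.1.1 <= t.1.2, 0 < t.2, squarefree (t.1.1 * t.1.2)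
      & t.1.1 * t.1.2 ^ 2 * t.2 ^ 3 <= n] (t \in smaller_triples n).
Proof. by rewrite inE; apply: and5P. Qed.

Lemma card_segment n : #|segment n| = n.
Proof.
have -> : segment n = [set~ ord0]%SET.
  by apply/setP => i; rewrite !inE lt0n.
by rewrite cardsC1 card_ord.
Qed.

(** The complement of an admissible A is at least as large as the set of smaller
    triples: send a triple to m = x y^2 z^3 if m lies outside A, and otherwise to
    its partner y x^2 z^3, which is at most m and cannot lie in A because its
    product with m is a cube. *)
Lemma card_cube_free_le n (A : {set 'I_n.+1}) :
  A \subset segment n -> no_cube_pair A -> #|A| + #|smaller_triples n| <= n.
Proof.
move=> AS nA.
pose m (t : 'I_n.+1 * 'I_n.+1 * 'I_n.+1) : nat := t.1.1 * t.1.2 ^ 2 * t.2 ^ 3.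
pose m' (t : 'I_n.+1 * 'I_n.+1 * 'I_n.+1) : nat := t.1.2 * t.1.1 ^ 2 * t.2 ^ 3.
pose phi t : 'I_n.+1 := inord (if inord (m t) \in A then m' t else m t).
have mn t : t \in smaller_triples n -> 0 < m t <= n.
  move=> /smaller_triplesP[x0 xy z0 _ ->]; have y0 := leq_trans x0 xy.
  by rewrite /m !(muln_gt0, expn_gt0) x0 y0 z0.
have m'n t : t \in smaller_triples n -> 0 < m' t <= n.
  move=> /smaller_triplesP[x0 xy z0 _ le]; have y0 := leq_trans x0 xy.
  rewrite /m' !(muln_gt0, expn_gt0) x0 y0 z0 /=; apply: leq_trans le.
  by rewrite leq_mul2r; apply/orP; right; nia.
have val_phi t : t \in smaller_triples n ->
    phi t = (if inord (m t) \in A then m' t else m t) :> nat.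
  by move=> tT; rewrite /phi inordK //; case: ifP => _;
    [case/andP: (m'n t tT)|case/andP: (mn t tT)].
have phiS : phi @: smaller_triples n \subset segment n :\: A.
  apply/fintype.subsetP => _ /imsetP[t tT ->]; rewrite !inE val_phi //.
  apply/andP; split; last by case: ifP => _; [case/andP: (m'n t tT)|case/andP: (mn t tT)].
  apply/negP; rewrite /phi; case: ifP => [mA m'A|->//].
  apply: (nA _ _ mA m'A).
  have /andP[_ h] := mn t tT; have /andP[_ h'] := m'n t tT.
  rewrite !inordK //; case/smaller_triplesP: tT => x0 xy z0 _ _.
  exact: cube_pair_partner x0 (leq_trans x0 xy) z0.
have phiI : {in smaller_triples n &, injective phi}.
  move=> t s tT sT /(congr1 (@nat_of_ord _)); rewrite !val_phi // => e.
  have uniq3 (t1 s1 : 'I_n.+1 * 'I_n.+1 * 'I_n.+1) :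
      [/\ t1.1.1 = s1.1.1 :> nat, t1.1.2 = s1.1.2 :> nat & t1.2 = s1.2 :> nat] ->
      t1 = s1.
    by move: t1 s1 => [[? ?] ?] [[? ?] ?] /= [? ? ?]; congr (_, _, _); apply: val_inj.
  (* If the partner y x^2 z^3 of t1 is the element indexed by s1, uniqueness makes s1
     the swap of t1; both being ordered, x = y and the two triples coincide. *)
  have mixed t1 s1 : t1 \in smaller_triples n -> s1 \in smaller_triples n ->
      m' t1 = m s1 -> t1 = s1.
    case/smaller_triplesP=> x0 xy z0 sq _; case/smaller_triplesP=> x'0 xy' z'0 sq' _.
    move=> e1; rewrite mulnC in sq.
    have [] := cubic_decomposition_uniq (leq_trans x0 xy) x0 z0 x'0
                 (leq_trans x'0 xy') z'0 sq sq' e1.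
    by move=> e2 e3 e4; apply: uniq3; split=> //; lia.
  move: e; case: ifP => tA; case: ifP => sA e.
  - case/smaller_triplesP: (tT) (sT) => x0 xy z0 sq _; case/smaller_triplesP=> x'0 xy' z'0 sq' _.
    rewrite mulnC in sq; rewrite mulnC in sq'.
    have [] := cubic_decomposition_uniq (leq_trans x0 xy) x0 z0
                 (leq_trans x'0 xy') x'0 z'0 sq sq' e.
    by move=> *; apply: uniq3.
  - exact: mixed.
  - by symmetry; apply: mixed.
  - case/smaller_triplesP: (tT) (sT) => x0 xy z0 sq _; case/smaller_triplesP=> x'0 xy' z'0 sq' _.
    apply: uniq3; exact: (cubic_decomposition_uniq x0 (leq_trans x0 xy) z0 x'0
                            (leq_trans x'0 xy') z'0 sq sq' e).
have := subset_leq_card phiS; rewrite (card_in_imset phiI) cardsD.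
rewrite (finset.setIidPr AS) card_segment.
by rewrite leq_subRL // -[leqRHS]card_segment subset_leq_card.
Qed.

(** The bound above is attained by the set of the elements x y^2 z^3 of [n] with
    x > y: two of these are never in inverse classes. *)
Lemma f23E n : f23 n + #|smaller_triples n| = n.
Proof.
apply/eqP; rewrite eqn_leq; apply/andP; split.
  have [A /andP[AS /asboolP nA] ->] :
      {A : {set 'I_n.+1} | (A \subset segment n) && `[< no_cube_pair A >]
                         & f23 n = #|A|}.
    apply: eq_bigmax_cond; apply/card_gt0P; exists finset.set0.
    rewrite unfold_in finset.sub0set; apply/asboolP => a b; by rewrite inE.
  exact: card_cube_free_le.
pose psi (t : 'I_n.+1 * 'I_n.+1 * 'I_n.+1) : 'I_n.+1 :=
  inord (t.1.1 * t.1.2 ^ 2 * t.2 ^ 3).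
pose A := segment n :\: psi @: smaller_triples n.
have AC : n <= #|A| + #|smaller_triples n|.
  have := leq_imset_card psi (smaller_triples n).
  have := subset_leq_card (finset.subsetIr (segment n) (psi @: smaller_triples n)).
  rewrite /A cardsD card_segment => h h'.
  by rewrite addnC -leq_subLR leq_sub2l // (leq_trans h h').
apply: leq_trans AC _; rewrite leq_add2r.
apply: leq_bigmax_cond; rewrite finset.subsetDl; apply/asboolP.
have large (a : 'I_n.+1) : a \in A -> exists x y z,
    [/\ 0 < y, y < x, 0 < z, squarefree (x * y) & a = x * y ^ 2 * z ^ 3 :> nat].
  rewrite !inE => /andP[aT a0]; have [x [y [z [x0 y0 z0 sxy aE]]]] := cubic_decomposition a0.
  exists x, y, z; split=> //; rewrite ltnNge; apply: contra aT => xy.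
  have an : x * y ^ 2 * z ^ 3 <= n by rewrite -aE -ltnS.
  have [xn yn zn] : [/\ x < n.+1, y < n.+1 & z < n.+1].
    by split; rewrite ltnS (leq_trans _ an) // -aE dvdn_leq // aE;
      [rewrite -mulnA dvdn_mulr|rewrite dvdn_mulr // dvdn_mull // dvdn_exp
      |rewrite dvdn_mull // dvdn_exp].
  apply/imsetP; exists (Ordinal xn, Ordinal yn, Ordinal zn); first by apply/smaller_triplesP.
  by apply: val_inj; rewrite /= inordK.
move=> a b /large[x [y [z [y0 yx z0 sq ->]]]] /large[x' [y' [z' [y'0 yx' z'0 sq' ->]]]].
move=> /cube_pair_swap[||||||||] //; try lia.
Qed.

(** If a^2 = w^3 then w^3 divides a^3, so w divides a and a = (a / w)^3. *)
Lemma positive_cube_sqrt a : 0 < a -> positive_cube (a * a) -> positive_cube a.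
Proof.
move=> a0 [w [w0 e]].
have /dvdnP[k aE] : w %| a.
  by rewrite -(dvdn_pexp2r _ _ (isT : 0 < 3)) -e (expnSr a 2) expnS expn1 dvdn_mulr.
exists k; split; first by nia.
apply/eqP; rewrite -(eqn_pmul2r (_ : 0 < w ^ 3)) ?expn_gt0 ?w0 //.
by rewrite -{1}e -expnMn -aE; apply/eqP; lia.
Qed.

Lemma f23_leF n : f23 n <= F23 n.
Proof.
apply/bigmax_leqP => A /andP[AS /asboolP nA].
apply: leq_bigmax_cond; rewrite AS; apply/asboolP => a b aA bA _; exact: nA.
Qed.

(** Two cubes have a cube as product, so an admissible set for distinct pairs
    contains at most one cube; without it the set is admissible for all pairs. *)
Lemma F23_le n : F23 n <= (f23 n).+1.
Proof.
apply/bigmax_leqP => A /andP[AS /asboolP nA].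
pose C := [set a in A | `[< positive_cube a >]]%SET.
have C1 : #|C| <= 1.
  apply: contrapT => /negP; rewrite -ltnNge => /card_gt1P[a [b [aC bC ab]]].
  move: aC bC; rewrite !inE => /andP[aA /asboolP[x [x0 ax]]] /andP[bA /asboolP[y [y0 bY]]].
  apply: (nA a b aA bA); first exact/eqP.
  by exists (x * y); rewrite muln_gt0 x0 y0 expnMn -ax -bY.
have -> : #|A| = #|A :&: C| + #|A :\: C| by rewrite cardsID.
rewrite -[X in _ <= X]add1n leq_add //.
  exact: leq_trans (subset_leq_card (finset.subsetIr _ _)) C1.
apply: leq_bigmax_cond; rewrite (fintype.subset_trans (finset.subsetDl _ _) AS).
apply/asboolP => a b; rewrite !inE => /andP[+ aA] /andP[bC bA].
rewrite aA /= => /asboolP aC; case: (eqVneq a b) => [<-|/eqP ab]; last exact: nA.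
have a0 : 0 < a by have /fintype.subsetP/(_ a aA) := AS; rewrite inE.
by move=> /(positive_cube_sqrt a0)/aC.
Qed.

End CubicDecomposition.

Local Open Scope ring_scope.

(** * Sums of inverse squares, periodic sequences and monotone weights *)

Lemma sum_multiples (V : nmodType) (F : nat -> V) (d n : nat) : (0 < d)%N ->
  \sum_(1 <= i < n.+1 | (d %| i)%N) F i =
  \sum_(1 <= j < (n %/ d).+1) F (d * j)%N.
Proof.
move=> d0; elim: n => [|n IH]; first by rewrite div0n !big_geq.
rewrite big_mkcond big_nat_recr //= -big_mkcond IH divnS //.
case: (boolP (d %| n.+1)%N) => [dv|_]; last by rewrite add0n addr0.
rewrite add1n [RHS]big_nat_recr //=; congr (_ + F _).
by have := divnS n d0; rewrite dv add1n => <-; rewrite mulnC divnK.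
Qed.

(** Comparison with the telescoping sum of 1/(s + e (j-1)) - 1/(s + e j), each
    divided by e. *)
Lemma sum_inv_sqr_le (R : realFieldType) (s e : R) (n : nat) :
  0 < s -> 0 < e ->
  \sum_(1 <= j < n.+1) ((s + e * j%:R) ^+ 2)^-1 <= (e * s)^-1.
Proof.
move=> s0 e0.
suff h : \sum_(1 <= j < n.+1) ((s + e * j%:R) ^+ 2)^-1
      <= (e * s)^-1 - (e * (s + e * n%:R))^-1.
  by apply: le_trans h _; rewrite gerBl invr_ge0 mulr_ge0 ?ltW // ltr_wpDr // mulr_ge0 // ltW.
elim: n => [|n IH]; first by rewrite big_geq // mulr0 addr0 subrr.
rewrite big_nat_recr //=; apply: le_trans (lerD IH (lexx _)) _.
rewrite -[n.+1%:R]natr1 [e * (_ + 1)]mulrDr mulr1 addrA; set t := s + e * n%:R.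
have t0 : 0 < t by rewrite ltr_wpDr // mulr_ge0 // ltW.
have te0 : 0 < t + e by rewrite addr_gt0.
rewrite -addrA lerD2l -subr_ge0.
have -> : - (e * (t + e))^-1 - (- (e * t)^-1 + ((t + e) ^+ 2)^-1) =
   e / (t * (t + e) ^+ 2) by field; rewrite !gt_eqF.
by rewrite divr_ge0 ?ltW // mulr_gt0 // exprn_gt0.
Qed.

Lemma sum_inv_sqr_tail (R : realFieldType) (q n : nat) : (0 < q)%N ->
  \sum_(q.+1 <= d < n) (d%:R ^+ 2)^-1 <= q%:R^-1 :> R.
Proof.
move=> q0; rewrite -[q.+1]add1n big_addn.
have [le|gt] := leqP (n - q) 0.
  by rewrite big_geq ?invr_ge0 ?ler0n //; lia.
have h := @sum_inv_sqr_le R q%:R 1 (n - q).-1.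
rewrite prednK // mul1r in h; apply: le_trans (h _ _) => //; last by rewrite ltr0n.
by apply: ler_sum => j _; rewrite mul1r natrD addrC.
Qed.

Section InverseSquares.
Variable R : realType.

Definition inv_sqr_sum n : R := \sum_(1 <= z < n.+1) (z%:R ^+ 2)^-1.

Lemma inv_sqr_sum_le2 n : inv_sqr_sum n <= 2.
Proof.
rewrite /inv_sqr_sum; case: n => [|n]; first by rewrite big_geq.
rewrite big_ltn // expr1n invr1.
by have := @sum_inv_sqr_tail R 1 n.+2 isT; rewrite invr1; lra.
Qed.

Lemma inv_sqr_sum_mono m n : (m <= n)%N -> inv_sqr_sum m <= inv_sqr_sum n.
Proof.
move=> mn; rewrite /inv_sqr_sum (@big_cat_nat _ _ _ m.+1 1 n.+1) //= lerDl.
by apply: sumr_ge0 => k _; rewrite invr_ge0 sqr_ge0.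
Qed.

End InverseSquares.

Section Periodic.
Variables (R : realFieldType) (M : nat) (f : nat -> R).
Hypotheses (M0 : (0 < M)%N) (fM : forall i, f (i + M)%N = f i).

Lemma periodic_sum n : \sum_(n <= i < n + M) f i = \sum_(0 <= i < M) f i.
Proof.
elim: n => [|n IH]; first by rewrite add0n.
rewrite -IH addSn big_nat_recr ?leq_addl //=; last by lia.
by rewrite fM [RHS]big_ltn 1?addrC //; lia.
Qed.

Definition mean : R := (\sum_(0 <= i < M) f i) / M%:R.

Hypothesis f01 : forall i, 0 <= f i <= 1.

Lemma mean01 : 0 <= mean <= 1.
Proof.
have M0' : 0 < M%:R :> R by rewrite ltr0n.
rewrite /mean divr_ge0 ?ler0n //=; last by apply: sumr_ge0 => i _; case/andP: (f01 i).
rewrite ler_pdivrMr // mul1r.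
apply: le_trans (ler_sum _ (fun i _ => proj2 (andP (f01 i)))) _.
by rewrite sumr_const_nat subn0.
Qed.

(** The deviations from the mean sum to 0 over a full period, so only an incomplete
    period contributes. *)
Lemma periodic_discrepancy n : `|\sum_(1 <= i < n.+1) (f i - mean)| <= M%:R.
Proof.
elim/ltn_ind: n => n IH.
have M0' : 0 < M%:R :> R by rewrite ltr0n.
have [nM|Mn] := ltnP n M.
  apply: le_trans (ler_norm_sum _ _ _) _.
  apply: (@le_trans _ _ (\sum_(1 <= i < n.+1) 1)).
    apply: ler_sum => i _; have := f01 i; have := mean01.
    by rewrite ler_norml => /andP[? ?] /andP[? ?]; apply/andP; split; lra.
  by rewrite sumr_const_nat subn1 /= ler_nat ltnW.
have := IH (n - M)%N; rewrite ltn_subrL M0 (leq_trans M0 Mn) => /(_ isT).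
rewrite (@big_cat_nat _ _ _ (n - M).+1 1 n.+1) //=; last by lia.
suff -> : \sum_((n - M).+1 <= i < n.+1) (f i - mean) = 0 by rewrite addr0.
have {1}-> : n.+1 = ((n - M).+1 + M)%N by lia.
rewrite sumrB periodic_sum sumr_const_nat -mulr_natr addKn /mean.
by rewrite divfK ?subrr // gt_eqF.
Qed.

End Periodic.

(** Abel summation: the increments of a monotone weight add up to at most U. *)
Lemma abel_summation_bound (R : realFieldType) (c a : nat -> R) (C U : R) n :
  (forall k, `|\sum_(1 <= i < k.+1) c i| <= C) ->
  (forall i, 0 <= a i <= U) -> (forall i, a i <= a i.+1) ->
  `|\sum_(1 <= i < n.+1) c i * a i| <= 2 * (C * U).
Proof.
move=> cC aU am; pose S k := \sum_(1 <= i < k.+1) c i.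
have C0 : 0 <= C by apply: le_trans (cC 0%N).
have -> : \sum_(1 <= i < n.+1) c i * a i =
    S n * a n.+1 - \sum_(1 <= i < n.+1) S i * (a i.+1 - a i).
  elim: n => [|n IH]; first by rewrite /S !big_geq // mul0r subr0.
  rewrite [LHS]big_nat_recr // [in RHS]big_nat_recr //= IH.
  by rewrite [S n.+1]big_nat_recr //= -/(S n); ring.
have h1 : `|S n * a n.+1| <= C * U.
  have /andP[a0 a1] := aU n.+1.
  by rewrite normrM (ger0_norm a0); apply: ler_pM => //; apply: cC.
have h2 : `|\sum_(1 <= i < n.+1) S i * (a i.+1 - a i)| <= C * U.
  apply: le_trans (ler_norm_sum _ _ _) _.
  apply: (@le_trans _ _ (\sum_(1 <= i < n.+1) C * (a i.+1 - a i))).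
    apply: ler_sum => i _; rewrite normrM (ger0_norm (_ : 0 <= a i.+1 - a i)) ?subr_ge0 //.
    by apply: ler_wpM2r; [rewrite subr_ge0|apply: cC].
  rewrite -mulr_sumr telescope_sumr //; apply: ler_wpM2l => //.
  by have /andP[? ?] := aU n.+1; have /andP[? ?] := aU 1%N; lra.
apply: le_trans (ler_normB _ _) _; lra.
Qed.

(** Here A plays the role of the integral of a; the hypothesis is what monotonicity
    of a gives on a unit interval, and the errors telescope. *)
Lemma sum_vs_primitive (R : realFieldType) (a A : nat -> R) n :
  (forall i, a i <= A i.+1 - A i <= a i.+1) ->
  0 <= \sum_(1 <= i < n.+1) a i - (A n - A 0%N) <= a n - a 0%N.
Proof.
move=> h; elim: n => [|n /andP[IH1 IH2]]; first by rewrite big_geq // !subrr lexx.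
rewrite big_nat_recr //=; have /andP[? ?] := h n.
by apply/andP; split; lra.
Qed.

Lemma sum_periodic_monotone (R : realFieldType) (M : nat) (f a A : nat -> R) (U : R) n :
  (0 < M)%N -> (forall i, f (i + M)%N = f i) -> (forall i, 0 <= f i <= 1) ->
  (forall i, 0 <= a i <= U) -> (forall i, a i <= a i.+1) ->
  (forall i, a i <= A i.+1 - A i <= a i.+1) ->
  `|\sum_(1 <= i < n.+1) f i * a i - mean M f * (A n - A 0%N)| <= 3 * M%:R * U.
Proof.
move=> M0 fM f01 aU am aA.
have -> : \sum_(1 <= i < n.+1) f i * a i - mean M f * (A n - A 0%N) =
  \sum_(1 <= i < n.+1) (f i - mean M f) * a i +
  mean M f * (\sum_(1 <= i < n.+1) a i - (A n - A 0%N)).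
  under [in RHS]eq_bigr do rewrite mulrBl.
  by rewrite sumrB -mulr_sumr; ring.
have U0 : 0 <= U by have /andP[] := aU 0%N; apply: le_trans.
have M1 : 1 <= M%:R :> R by rewrite ler1n.
have h1 := abel_summation_bound n (periodic_discrepancy M0 fM f01) aU am.
have /andP[h2 h3] := sum_vs_primitive n aA.
have /andP[m0 m1] := mean01 M0 f01.
have h4 : `|mean M f * (\sum_(1 <= i < n.+1) a i - (A n - A 0%N))| <= U.
  rewrite normrM (ger0_norm m0) (ger0_norm h2).
  apply: le_trans (ler_piMl h2 m1) _.
  by have /andP[? ?] := aU n; have /andP[? ?] := aU 0%N; lra.
apply: le_trans (ler_normD _ _) _.
have : U <= M%:R * U by rewrite ler_peMl.
rewrite -[3 * _ * _]mulrA; lra.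
Qed.

(** * The density of pairs passing the sieve *)

(** The Chinese remainder theorem in summation form. *)
Lemma sum_residue_pairs (V : nmodType) (Phi : nat -> nat -> V) (a b : nat) :
  (0 < a)%N -> (0 < b)%N -> coprime a b ->
  \sum_(0 <= x < a * b) Phi (x %% a)%N (x %% b)%N =
  \sum_(0 <= i < a) \sum_(0 <= j < b) Phi i j.
Proof.
move=> a0 b0 cab; rewrite !big_mkord.
under [RHS]eq_bigr do rewrite big_mkord.
rewrite pair_big /=.
pose h (x : 'I_(a * b)) : 'I_a * 'I_b :=
  (Ordinal (ltn_pmod x a0), Ordinal (ltn_pmod x b0)).
have hI : injective h.
  move=> x y [] /eqP e1 /eqP e2; apply: val_inj => /=.
  have := chinese_remainder cab x y; rewrite e1 e2 /= => /eqP.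
  by rewrite !modn_small.
have hB : bijective h by apply: inj_card_bij => //; rewrite card_prod !card_ord.
by rewrite (reindex h) //=; apply: onW_bij.
Qed.

(** Independence of conditions on pairs of residues to coprime moduli. *)
Lemma sum_residue_pairs_prod (R : pzSemiRingType) (f g : nat -> nat -> R) (a b : nat) :
  (0 < a)%N -> (0 < b)%N -> coprime a b ->
  (forall x y, f (x %% a)%N (y %% a)%N = f x y) ->
  (forall x y, g (x %% b)%N (y %% b)%N = g x y) ->
  \sum_(0 <= x < a * b) \sum_(0 <= y < a * b) f x y * g x y =
  (\sum_(0 <= x < a) \sum_(0 <= y < a) f x y) *
  (\sum_(0 <= x < b) \sum_(0 <= y < b) g x y).
Proof.
move=> a0 b0 cab fa gb.
transitivity (\sum_(0 <= x < a * b) \sum_(0 <= k < a) \sum_(0 <= l < b)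
     f (x %% a)%N k * g (x %% b)%N l).
  apply: eq_bigr => x _.
  rewrite -(sum_residue_pairs (fun k l => f (x %% a)%N k * g (x %% b)%N l)) //.
  by apply: eq_bigr => y _; rewrite fa gb.
rewrite (sum_residue_pairs (fun i j => \sum_(0 <= k < a) \sum_(0 <= l < b) f i k * g j l)) //.
rewrite big_distrl; apply: eq_bigr => i _ /=.
rewrite big_distrr; apply: eq_bigr => j _ /=.
rewrite big_distrl; apply: eq_bigr => k _ /=.
by rewrite big_distrr.
Qed.

Lemma prime_sqr_dvdM p x y : prime p ->
  (p ^ 2 %| x * y)%N = [|| (p ^ 2 %| x)%N, (p ^ 2 %| y)%N | (p %| x)%N && (p %| y)%N].
Proof.
move=> pp; have p0 := prime_gt0 pp.
have [->|x0] := posnP x; first by rewrite mul0n !dvdn0.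
have [->|y0] := posnP y; first by rewrite muln0 !dvdn0 orbT.
rewrite -[X in [|| _, _ | (X %| _)%N && _]]expn1 -[X in [|| _, _ | _ && (X %| _)%N]]expn1.
rewrite !pfactor_dvdn ?muln_gt0 ?x0 // lognM //; lia.
Qed.

Lemma count_dvd (R : pzSemiRingType) d n : (0 < d)%N -> (d %| n)%N ->
  \sum_(0 <= i < n) (d %| i)%N%:R = (n %/ d)%N%:R :> R.
Proof.
move=> d0 /dvdnP[k ->]; rewrite mulnK //; elim: k => [|k IH].
  by rewrite big_geq.
rewrite (@big_cat_nat _ _ _ (k * d)%N) //=; last by lia.
rewrite IH -natr1; congr (_ + _).
have [e|d1] := eqVneq d 1; first by rewrite e !muln1 big_nat1 dvd1n.
rewrite big_ltn; last by lia.
rewrite dvdn_mull // big_nat big1 ?addr0 // => i /andP[h1 h2].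
suff -> : (d %| i)%N = false by [].
apply/negP => /dvdnP[j ij]; move: h1 h2; rewrite ij !ltn_pmul2r //; lia.
Qed.

(** Inclusion and exclusion on: p^2 divides x, p^2 divides y, p divides both. *)
Lemma local_density (R : realFieldType) (p : nat) : prime p ->
  \sum_(0 <= x < p ^ 2) \sum_(0 <= y < p ^ 2) (~~ (p ^ 2 %| x * y)%N)%:R =
  ((p ^ 2) ^ 2)%N%:R * (1 - 3 / p%:R ^+ 2 + 2 / p%:R ^+ 3) :> R.
Proof.
move=> pp; have p0 : (0 < p)%N := prime_gt0 pp.
have pn0 : p%:R != 0 :> R by rewrite pnatr_eq0 -lt0n.
pose a x : R := (p %| x)%N%:R; pose b x : R := (p ^ 2 %| x)%N%:R.
have E x y : (~~ (p ^ 2 %| x * y)%N)%:R =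
    1 - b x - b y - a x * a y + b x * a y + a x * b y.
  rewrite /a /b prime_sqr_dvdM //.
  have h z : (p ^ 2 %| z)%N -> (p %| z)%N by apply: dvdn_trans; rewrite dvdn_exp.
  move: (h x) (h y).
  by do 4 case: (_ %| _)%N => //= ; move=> h1 h2; rewrite ?(h1 isT) ?(h2 isT); 
    try (by have := h1 isT); try (by have := h2 isT); rewrite /=; ring.
have sa : \sum_(0 <= x < p ^ 2) a x = p%:R.
  by rewrite /a count_dvd // ?dvdn_exp // expnS expn1 mulnK.
have sb : \sum_(0 <= x < p ^ 2) b x = 1.
  by rewrite /b count_dvd ?expn_gt0 ?p0 // divnn expn_gt0 p0.
have s1 (c : R) : \sum_(0 <= x < p ^ 2) c = p%:R ^+ 2 * c.
  by rewrite sumr_const_nat subn0 -[c *+ _]mulr_natl natrX.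
under eq_bigr do under eq_bigr do rewrite E.
under eq_bigr do rewrite !big_split /= !sumrN -!mulr_sumr sa sb !s1.
rewrite !big_split /= !sumrN -!mulr_suml sa sb !s1 -mulr_sumr sb !natrX.
by field.
Qed.

Definition sieve_modulus (P : nat) : nat := (\prod_(0 <= p < P | prime p) p ^ 2)%N.

Lemma sieve_modulus_gt0 P : (0 < sieve_modulus P)%N.
Proof. by apply: prodn_cond_gt0 => p pp; rewrite expn_gt0 prime_gt0. Qed.

Lemma sieve_modulusS P : sieve_modulus P.+1 =
  (sieve_modulus P * (if prime P then P ^ 2 else 1))%N.
Proof.
by rewrite /sieve_modulus big_mkcond big_nat_recr //= -big_mkcond.
Qed.

Lemma sqfree_belowS P m : sqfree_below P.+1 m = sqfree_below P m && (prime P ==> ~~ (P ^ 2 %| m)%N).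
Proof.
rewrite /sqfree_below -[P.+1]addn1 iotaD filter_cat all_cat add0n /=.
by case: (prime P) => //=; rewrite andbT.
Qed.

Lemma sqfree_below_mod P x y x' y' : x = x' %[mod sieve_modulus P] ->
  y = y' %[mod sieve_modulus P] -> sqfree_below P (x * y) = sqfree_below P (x' * y').
Proof.
elim: P => [//|P IH]; rewrite sieve_modulusS => ex ey.
have red d n m : n = m %[mod sieve_modulus P * d] ->
    n = m %[mod sieve_modulus P] /\ n = m %[mod d].
  have md k q : (q %| sieve_modulus P * d)%N ->
      (k %% (sieve_modulus P * d) = k %[mod q])%N by apply: modn_dvdm.
  have d1 : (sieve_modulus P %| sieve_modulus P * d)%N by rewrite dvdn_mulr.
  have d2 : (d %| sieve_modulus P * d)%N by rewrite dvdn_mull.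
  by move=> e; split; [rewrite -(md n _ d1) e md|rewrite -(md n _ d2) e md].
have [ex1 ex2] := red _ _ _ ex; have [ey1 ey2] := red _ _ _ ey.
rewrite !sqfree_belowS (IH ex1 ey1); case: (prime P) ex2 ey2 => //= ex2 ey2.
by rewrite /dvdn -modnMm ex2 ey2 modnMm.
Qed.

Lemma coprime_sieve_modulus P : prime P -> coprime (sieve_modulus P) (P ^ 2).
Proof.
move=> pP; rewrite /sieve_modulus coprime_sym big_nat_cond.
apply: (big_ind (fun m => coprime (P ^ 2) m)) => [|m n|p /andP[/andP[_ pltP] pp]].
- by rewrite coprimen1.
- by move=> hm hn; rewrite coprimeMr hm hn.
rewrite coprimeXl // coprimeXr // prime_coprime // dvdn_prime2 //.
by rewrite neq_ltn pltP orbT.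
Qed.

Lemma sieve_density (R : realType) P :
  \sum_(0 <= x < sieve_modulus P) \sum_(0 <= y < sieve_modulus P) (sqfree_below P (x * y))%:R =
  (sieve_modulus P ^ 2)%N%:R * \prod_(0 <= p < P | prime p) euler_factor R p :> R.
Proof.
elim: P => [|P IH].
  have -> : sieve_modulus 0 = 1%N by rewrite /sieve_modulus big_geq.
  by rewrite !big_nat1 big_geq //= mulr1.
rewrite sieve_modulusS [in RHS]big_mkcond big_nat_recr //= -big_mkcond /=.
case: (boolP (prime P)) => [pP|nP]; last first.
  by rewrite muln1 mulr1 -IH; do 2 apply: eq_bigr => ? _; rewrite sqfree_belowS (negPf nP) andbT.
rewrite expnMn natrM mulrACA -IH /euler_factor -local_density //.
rewrite -sum_residue_pairs_prod ?sieve_modulus_gt0 ?expn_gt0 ?prime_gt0 ?coprime_sieve_modulus //.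
- by do 2 apply: eq_bigr => ? _; rewrite sqfree_belowS pP /= -natrM mulnb.
- by move=> x y; congr (nat_of_bool _)%:R; apply: sqfree_below_mod; rewrite modn_mod.
- by move=> x y; rewrite /dvdn modnMm.
Qed.

(** * Lattice points in the region x <= y, x y^2 <= u^3 *)

Section Region.
Variable R : realType.
Implicit Types (u : R) (x y : nat).

(** The length of the row of ordinate y in the region x <= y, x y^2 <= u^3. *)
Definition row_length u y : R := Num.min y%:R (u ^+ 3 / y%:R ^+ 2).
Definition row_count u y : nat := Num.truncn (row_length u y).

(** The sum of F over the lattice points of the region with y <= B.  Rows with
    y > u^3 are empty, so that every integer B at least u^3 gives the full sum. *)
Definition region_sum (F : nat -> nat -> R) (B : nat) u : R :=
  \sum_(1 <= y < B.+1) \sum_(1 <= x < (row_count u y).+1) F x y.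

Lemma row_length_ge0 u y : 0 <= u -> 0 <= row_length u y.
Proof. by move=> u0; rewrite le_min ler0n divr_ge0 ?exprn_ge0 ?ler0n. Qed.

Lemma row_count_le u y : 0 <= u -> (row_count u y)%:R <= row_length u y.
Proof. by move=> u0; rewrite truncn_le row_length_ge0. Qed.

Lemma row_count_gt u y : row_length u y < (row_count u y)%:R + 1.
Proof. by rewrite natr1 truncnS_gt. Qed.

Lemma row_countP u x y : 0 <= u -> (0 < y)%N ->
  (x <= row_count u y)%N = (x <= y)%N && ((x * y ^ 2)%N%:R <= u ^+ 3).
Proof.
move=> u0 y0; rewrite truncn_ge_nat ?row_length_ge0 // le_min ler_nat; congr andb.
by rewrite natrM natrX ler_pdivlMr // exprn_gt0 // ltr0n.
Qed.

(** A smooth majorant of min(c, u^3 / y^2), up to a constant.  Its sum over y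
    telescopes (sum_inv_sqr_le), which avoids cutting the sum at the crossing point
    of the two terms. *)
Lemma le_inv_sqr_majorant (c s t : R) u y : 0 < s -> (0 < y)%N -> 0 <= t -> 0 <= c -> 0 <= u ->
  t <= c -> t <= u ^+ 3 / y%:R ^+ 2 ->
  t <= 4 * (c * s ^+ 2 + u ^+ 3) / (s + y%:R) ^+ 2.
Proof.
move=> s0 y0 t0 c0 u0 tc; have Y0 : 0 < y%:R :> R by rewrite ltr0n.
rewrite ler_pdivlMr ?exprn_gt0 // => tu.
rewrite ler_pdivlMr ?exprn_gt0 ?addr_gt0 //.
have u3 : 0 <= u ^+ 3 by rewrite exprn_ge0.
have h1 : t * s ^+ 2 <= c * s ^+ 2 by rewrite ler_wpM2r // exprn_ge0 // ltW.
have h2 : 0 <= t * (s - y%:R) ^+ 2 by rewrite mulr_ge0 // sqr_ge0.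
have -> : t * (s + y%:R) ^+ 2 =
  2 * (t * s ^+ 2) + 2 * (t * y%:R ^+ 2) - t * (s - y%:R) ^+ 2 by ring.
have h3 : 0 <= c * s ^+ 2 by rewrite mulr_ge0 // exprn_ge0 // ltW.
lra.
Qed.

Lemma row_length_le_inv_sqr u y : 0 < u -> (0 < y)%N ->
  row_length u y <= 8 * u ^+ 3 / (u + y%:R) ^+ 2.
Proof.
move=> u0 y0; have u0' := ltW u0.
have hu : row_length u y <= u.
  rewrite ge_min; have [yu|uy] := leP y%:R u; first by [].
  rewrite ler_pdivrMr ?exprn_gt0 ?ltr0n // exprS ler_wpM2l //.
  by rewrite lerXn2r ?nnegrE ?ler0n // ltW.
have := le_inv_sqr_majorant u0 y0 (row_length_ge0 y u0') u0' u0' hu.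
have -> : 4 * (u * u ^+ 2 + u ^+ 3) = 8 * u ^+ 3 by ring.
by apply; rewrite ge_min lexx orbT.
Qed.

(** The constant 8 is uniform in d and e, even when the sublattice is coarser than
    the region: this is what makes the contribution of the large primes summable. *)
Lemma sublattice_count (d e B : nat) u : (0 < d)%N -> (0 < e)%N -> 0 < u ->
  region_sum (fun x y => (d %| x)%N%:R * (e %| y)%N%:R) B u
    <= 8 * u ^+ 2 / (d%:R * e%:R).
Proof.
move=> d0 e0 u0; have u0' := ltW u0.
have d0' : 0 < d%:R :> R by rewrite ltr0n.
have e0' : 0 < e%:R :> R by rewrite ltr0n.
have row y : (0 < y)%N -> \sum_(1 <= x < (row_count u y).+1) (d %| x)%N%:R
    <= 8 * u ^+ 3 / d%:R * ((u + y%:R) ^+ 2)^-1.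
  move=> y0.
  have -> : \sum_(1 <= x < (row_count u y).+1) (d %| x)%N%:R = (row_count u y %/ d)%N%:R :> R.
    transitivity (\sum_(1 <= x < (row_count u y).+1 | (d %| x)%N) (1 : R)).
      by rewrite [RHS]big_mkcond; apply: eq_bigr => x _; case: ifP.
    by rewrite sum_multiples // sumr_const_nat subn1.
  rewrite mulrAC ler_pdivlMr // -natrM.
  apply: le_trans (row_length_le_inv_sqr u0 y0); apply: le_trans (row_count_le y u0').
  by rewrite ler_nat leq_trunc_div.
apply: (@le_trans _ _ (\sum_(1 <= y < B.+1 | (e %| y)%N)
    8 * u ^+ 3 / d%:R * ((u + y%:R) ^+ 2)^-1)).
  rewrite [leRHS]big_mkcond /= /region_sum !big_nat; apply: ler_sum => y /andP[y0 _].
  rewrite -mulr_suml; case: ifP => _; last by rewrite mulr0.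
  by rewrite mulr1 row.
rewrite sum_multiples // -mulr_sumr.
have h := sum_inv_sqr_le (B %/ e) u0 e0'.
under eq_bigr do rewrite natrM.
have c0 : 0 <= 8 * u ^+ 3 / d%:R by rewrite divr_ge0 ?ltW // mulr_gt0 // exprn_gt0.
apply: le_trans (ler_wpM2l c0 h) _.
by rewrite le_eqVlt; apply/orP; left; apply/eqP; field; rewrite !gt_eqF.
Qed.

(** If x y passes the sieve up to Q but is not squarefree, then p^2 divides x y for
    some prime p > Q; so p^2 divides x, p^2 divides y, or p divides both. *)
Lemma sieve_excess_pointwise Q B x y : (0 < x <= y)%N -> (y <= B)%N ->
  (sqfree_below Q.+1 (x * y))%:R - (squarefree (x * y))%:R <=
  \sum_(Q.+1 <= d < B.+1) ((d ^ 2 %| x)%N%:R * (1 %| y)%N%:R +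
     (1 %| x)%N%:R * (d ^ 2 %| y)%N%:R + (d %| x)%N%:R * (d %| y)%N%:R) :> R.
Proof.
move=> /andP[x0 xy] yB; have y0 := leq_trans x0 xy.
have S0 m n p q : 0 <= \sum_(Q.+1 <= d < B.+1) ((m d : bool)%:R * (n d : bool)%:R +
     (p d : bool)%:R * (q d : bool)%:R + (d %| x)%N%:R * (d %| y)%N%:R) :> R.
  by apply: sumr_ge0 => d _; rewrite !addr_ge0 // mulr_ge0.
case: (boolP (squarefree _)) => [_|nsq].
  by apply: le_trans (S0 _ _ _ _); rewrite subr_le0 lern1 leq_b1.
rewrite subr0; case: (boolP (sqfree_below _ _)) => [sQ|_]; last exact: S0.
have xy0 : (0 < x * y)%N by rewrite muln_gt0 x0.
have [p pp /negPn pxy] : exists2 p, prime p & ~~ ~~ (p ^ 2 %| x * y)%N.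
  apply: contrapT => h; case/negP: nsq; apply/(squarefreeP xy0) => p pp.
  by apply/negP => hp; apply: h; exists p => //; rewrite hp.
have Qp : (Q.+1 <= p)%N.
  by rewrite leqNgt; apply/negP => pQ; have /sqfree_belowP/(_ p pp pQ) := sQ; rewrite pxy.
have pB : (p < B.+1)%N.
  have : (p %| x * y)%N by apply: dvdn_trans pxy; rewrite dvdn_exp.
  rewrite Euclid_dvdM // ltnS => /orP[/(dvdn_leq x0)|/(dvdn_leq y0)] h; lia.
rewrite (bigD1_seq p) /= ?iota_uniq //; last by rewrite mem_index_iota Qp pB.
rewrite -[leLHS]addr0 lerD //; last first.
  by apply: sumr_ge0 => d _; rewrite !addr_ge0 // mulr_ge0.
rewrite !dvd1n !mulr1 !mul1r -natrM mulnb -!natrD ler_nat.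
by move: pxy; rewrite prime_sqr_dvdM //; do 2 case: (_ ^ 2 %| _)%N => //=; case: (_ && _).
Qed.

Lemma region_sum_le (F G : nat -> nat -> R) (B : nat) u : 0 <= u ->
  (forall x y, (0 < x <= y)%N -> (y <= B)%N -> F x y <= G x y) ->
  region_sum F B u <= region_sum G B u.
Proof.
move=> u0 FG; rewrite /region_sum !big_nat; apply: ler_sum => y /andP[y0 yB].
rewrite !big_nat; apply: ler_sum => x /andP[x0]; rewrite ltnS row_countP // => /andP[xy _].
by apply: FG; rewrite ?x0.
Qed.

Lemma sieve_excess Q B u : (0 < Q)%N -> 0 < u ->
  0 <= region_sum (fun x y => (sqfree_below Q.+1 (x * y))%:R) B u
       - region_sum (fun x y => (squarefree (x * y))%:R) B u
    <= 24 * u ^+ 2 / Q%:R.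
Proof.
move=> Q0 u0; have u0' := ltW u0; apply/andP; split.
  rewrite subr_ge0; apply: region_sum_le => // x y /andP[x0 xy] _.
  rewrite ler_nat; case: (boolP (squarefree _)) => // /squarefreeP.
  rewrite muln_gt0 x0 (leq_trans x0 xy) => /(_ isT) sq.
  by case: sqfree_belowP => // -[] p pp _; apply: sq.
have -> : region_sum (fun x y => (sqfree_below Q.+1 (x * y))%:R) B u
       - region_sum (fun x y => (squarefree (x * y))%:R) B u =
   region_sum (fun x y => (sqfree_below Q.+1 (x * y))%:R - (squarefree (x * y))%:R) B u.
  by rewrite /region_sum -sumrB; apply: eq_bigr => y _; rewrite sumrB.
apply: le_trans (region_sum_le u0' (@sieve_excess_pointwise Q B)) _.
have -> : forall F : nat -> nat -> nat -> R,
   region_sum (fun x y => \sum_(Q.+1 <= d < B.+1) F d x y) B u =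
   \sum_(Q.+1 <= d < B.+1) region_sum (F d) B u.
  move=> F; rewrite /region_sum; under eq_bigr do rewrite exchange_big.
  by rewrite exchange_big.
apply: (@le_trans _ _ (\sum_(Q.+1 <= d < B.+1) 24 * u ^+ 2 * (d%:R ^+ 2)^-1)).
  rewrite big_nat [leRHS]big_nat; apply: ler_sum => d /andP[Qd _].
  have d0 : (0 < d)%N by lia.
  have split3 (F G H : nat -> nat -> R) : region_sum (fun x y => F x y + G x y + H x y) B u
      = region_sum F B u + region_sum G B u + region_sum H B u.
    by rewrite /region_sum -!big_split; apply: eq_bigr => y _; rewrite !big_split.
  rewrite split3.
  have h1 := @sublattice_count (d ^ 2) 1 B u _ isT u0.
  have h2 := @sublattice_count 1 (d ^ 2) B u isT _ u0.
  have h3 := @sublattice_count d d B u d0 d0 u0.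
  rewrite expn_gt0 d0 natrX mulr1 in h1; rewrite expn_gt0 d0 natrX mul1r in h2.
  rewrite -expr2 in h3.
  have := h1 isT; have := h2 isT.
  by move: h3; rewrite -!mulrA; lra.
rewrite -mulr_sumr ler_wpM2l ?sum_inv_sqr_tail // mulr_ge0 // exprn_ge0 //.
Qed.

(** The row length increases up to y = u and decreases afterwards.  It is written
    as a difference of two nondecreasing bounded functions, in order that the
    estimates for monotone weights apply. *)
Lemma row_lengthE u y : 1 <= u -> (0 < y)%N ->
  row_length u y = Num.min y%:R u - (u - u ^+ 3 / (Num.max y%:R u) ^+ 2).
Proof.
move=> u1 y0; have u0 : 0 < u by apply: lt_le_trans u1.
have Y0 : 0 < y%:R :> R by rewrite ltr0n.
rewrite /row_length; case: (leP y%:R u) => [yu|/ltW uy].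
  have -> : Num.min y%:R (u ^+ 3 / y%:R ^+ 2) = y%:R.
    apply/min_l; rewrite ler_pdivlMr ?exprn_gt0 // -exprS.
    by rewrite lerXn2r ?nnegrE ?(ltW Y0) ?(ltW u0).
  by field; rewrite gt_eqF.
have -> : Num.min y%:R (u ^+ 3 / y%:R ^+ 2) = u ^+ 3 / y%:R ^+ 2.
  apply/min_r; rewrite ler_pdivrMr ?exprn_gt0 // -exprS.
  by rewrite lerXn2r ?nnegrE ?(ltW Y0) ?(ltW u0).
by ring.
Qed.

(** The area of the region is u^2 / 2 below y = u and u^2 above. *)
Lemma sum_periodic_row_length (M : nat) (f : nat -> R) B u :
  (0 < M)%N -> (forall i, f (i + M)%N = f i) -> (forall i, 0 <= f i <= 1) ->
  1 <= u -> u ^+ 3 <= B%:R ->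
  `|\sum_(1 <= y < B.+1) f y * row_length u y - mean M f * (3 / 2 * u ^+ 2)|
     <= 6 * M%:R * u + 1.
Proof.
move=> M0 fM f01 u1 uB; have u0 : 0 < u by apply: lt_le_trans u1.
have u0' := ltW u0.
(* A and Bf are the integrals from 0 of a and b, the parts of the row length that
   rise up to y = u and fall after it. *)
pose a y : R := Num.min y%:R u.
pose b y : R := u - u ^+ 3 / (Num.max y%:R u) ^+ 2.
pose A y : R := (Num.min y%:R u) ^+ 2 / 2 + u * (y%:R - Num.min y%:R u).
pose Bf y : R := u * Num.max y%:R u + u ^+ 3 / Num.max y%:R u - 2 * u ^+ 2.
have wu y : u <= Num.max y%:R u by rewrite le_max lexx orbT.
have w0 y : 0 < Num.max y%:R u :> R by apply: lt_le_trans (wu y).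
have inv_anti (s t : R) : 0 < s -> s <= t -> u ^+ 3 / t <= u ^+ 3 / s.
  move=> s0 st; rewrite ler_wpM2l ?exprn_ge0 // lef_pV2 ?posrE //.
  exact: lt_le_trans st.
have aU i : 0 <= a i <= u by rewrite /a le_min ler0n u0' ge_min lexx orbT.
have am i : a i <= a i.+1.
  by rewrite /a le_min !ge_min lexx orbT andbT ler_nat leqnSn.
have bU i : 0 <= b i <= u.
  rewrite /b subr_ge0 gerBl divr_ge0 ?exprn_ge0 ?(ltW (w0 _)) //= andbT.
  rewrite ler_pdivrMr ?exprn_gt0 // exprS ler_wpM2l //.
  by rewrite lerXn2r ?nnegrE ?(ltW (w0 _)).
have wm i : Num.max i%:R u <= Num.max i.+1%:R u :> R.
  by rewrite ge_max !le_max lexx orbT andbT ler_nat leqnSn.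
have bm i : b i <= b i.+1.
  rewrite /b lerD2l lerN2 inv_anti ?exprn_gt0 //.
  by rewrite lerXn2r ?nnegrE ?(ltW (w0 _)).
have aA i : a i <= A i.+1 - A i <= a i.+1.
  have iE : i.+1%:R = i%:R + 1 :> R by rewrite natr1.
  have i0 : 0 <= i%:R :> R by rewrite ler0n.
  rewrite /a /A iE; move: (i%:R : R) i0 => s s0.
  case: (leP s u) => h1; case: (leP (s + 1) u) => h2; apply/andP; split; try (by lra); nra.
have bB i : b i <= Bf i.+1 - Bf i <= b i.+1.
  have -> : Bf i.+1 - Bf i = (Num.max i.+1%:R u - Num.max i%:R u) *
     (u - u ^+ 3 / (Num.max i%:R u * Num.max i.+1%:R u)).
    by rewrite /Bf; field; rewrite !gt_eqF.
  have h1 : b i <= u - u ^+ 3 / (Num.max i%:R u * Num.max i.+1%:R u).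
    rewrite /b lerD2l lerN2 inv_anti ?exprn_gt0 //.
    by rewrite expr2 ler_wpM2l // ltW.
  have h2 : u - u ^+ 3 / (Num.max i%:R u * Num.max i.+1%:R u) <= b i.+1.
    rewrite /b lerD2l lerN2 inv_anti ?mulr_gt0 //.
    by rewrite expr2 ler_wpM2r // ltW.
  have /andP[b0 _] := bU i.
  have iE : i.+1%:R = i%:R + 1 :> R by rewrite natr1.
  have d1 : 0 <= Num.max i.+1%:R u - Num.max i%:R u :> R by rewrite subr_ge0.
  have d2 : Num.max i.+1%:R u - Num.max i%:R u <= 1 :> R.
    have iw : i%:R <= Num.max i%:R u :> R by rewrite le_max lexx.
    by rewrite iE lerBlDr ge_max; apply/andP; split; have := wu i; lra.
  have b1 : 0 <= b i.+1 by have /andP[] := bU i.+1.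
  apply/andP; split; last first.
    apply: le_trans h2; rewrite -[leRHS]mul1r ler_wpM2r //; exact: le_trans h1.
  have pos := le_trans b0 h1.
  case: (boolP (i%:R <= u)) => [iu|].
    have -> : b i = 0 by rewrite /b max_r //; field; rewrite gt_eqF.
    exact: mulr_ge0.
  rewrite -ltNge => /ltW iu.
  have -> : Num.max i.+1%:R u - Num.max i%:R u = 1 :> R.
    by rewrite iE !max_l // 1?addrAC ?subrr ?add0r //; lra.
  by rewrite mul1r.
have Ba : (1 <= B)%N by rewrite -(@ler_nat R); apply: le_trans uB; rewrite exprn_ege1.
have uB' : u <= B%:R by apply: le_trans uB; rewrite ler_eXnr.
have hE : \sum_(1 <= y < B.+1) f y * row_length u y =
   \sum_(1 <= y < B.+1) f y * a y - \sum_(1 <= y < B.+1) f y * b y.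
  rewrite -sumrB !big_nat; apply: eq_bigr => y /andP[y0 _].
  by rewrite row_lengthE // -/(a y) -/(b y) mulrBr.
have HA := sum_periodic_monotone B M0 fM f01 aU am aA.
have HB := sum_periodic_monotone B M0 fM f01 bU bm bB.
have EA : A B - A 0%N = u ^+ 2 / 2 + u * (B%:R - u).
  by rewrite /A (min_r uB') min_l ?ler0n //; ring.
have EB : Bf B - Bf 0%N = u * B%:R + u ^+ 3 / B%:R - 2 * u ^+ 2.
  rewrite /Bf (max_l uB') max_r ?ler0n //; field.
  by rewrite !gt_eqF // ltr0n.
have /andP[m0 m1] := mean01 M0 f01.
rewrite hE EA EB in HA HB *.
have q : 0 <= u ^+ 3 / B%:R <= 1.
  by rewrite divr_ge0 ?exprn_ge0 ?ler0n // ler_pdivrMr ?ltr0n // mul1r.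
move: HA HB q; set SA := \sum_(_ <= y < _) _ * a y; set SB := \sum_(_ <= y < _) _ * b y.
set mu := mean M f in m0 m1 *; set q := u ^+ 3 / _ => HA HB /andP[q0 q1].
have mq : 0 <= mu * q <= 1 by rewrite mulr_ge0 //= mulr_ile1.
have -> : SA - SB - mu * (3 / 2 * u ^+ 2) =
  (SA - mu * (u ^+ 2 / 2 + u * (B%:R - u))) -
  (SB - mu * (u * B%:R + q - 2 * u ^+ 2)) - mu * q by field.
apply: le_trans (ler_normB _ _) _; apply: lerD; last by case/andP: mq => ? ?; rewrite ger0_norm.
apply: le_trans (ler_normB _ _) _.
have -> : 6 * M%:R * u = 3 * M%:R * u + 3 * M%:R * u by ring.
exact: lerD.
Qed.

Definition sieve_product P : R := \prod_(0 <= p < P | prime p) euler_factor R p.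

(** The truncated sieve is periodic in x, so each row contributes its length times
    the mean rho(y) of that row, with a bounded error; rho is periodic in y, and
    its mean is the density of the sieve.  The row error is bounded both by a
    constant and by the row length, and is summed with the majorant
    le_inv_sqr_majorant at s = L u, where L is large. *)
Lemma region_sum_sieve P (eps : R) : 0 < eps -> exists2 K : R, 0 <= K &
  forall u B, 1 <= u -> u ^+ 3 <= B%:R ->
  `|region_sum (fun x y => (sqfree_below P (x * y))%:R) B u
     - sieve_product P * (3 / 2 * u ^+ 2)| <= eps * u ^+ 2 + K * u.
Proof.
move=> e0; pose M := sieve_modulus P; have M0 : (0 < M)%N := sieve_modulus_gt0 P.
pose g y x : R := (sqfree_below P (x * y))%:R.
have g01 y x : 0 <= g y x <= 1 by rewrite ler0n lern1 leq_b1.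
have gx y x : g y (x + M)%N = g y x.
  by congr (nat_of_bool _)%:R; apply: sqfree_below_mod; rewrite // modnDr.
pose rho y := mean M (g y).
have rho01 y : 0 <= rho y <= 1 by apply: mean01.
have rhoM y : rho (y + M)%N = rho y.
  congr (_ / _); apply: eq_bigr => x _.
  by congr (nat_of_bool _)%:R; apply: sqfree_below_mod; rewrite // modnDr.
have mu : mean M rho = sieve_product P.
  have := sieve_density R P; rewrite -/M => h.
  have Mn0 : M%:R != 0 :> R by rewrite pnatr_eq0 -lt0n.
  rewrite /mean /rho /mean -mulr_suml exchange_big /= /g h natrX.
  by rewrite /sieve_product; field.
(* C bounds the error of a row: at most M from the period and 1 from rounding. *)
pose C : R := M%:R + 1; have C0 : 0 < C by rewrite ltr_wpDl ?ler0n.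
pose L : R := 4 / eps; have L0 : 0 < L by rewrite divr_gt0.
exists (4 * C * L + 6 * M%:R + 1).
  have := mulr_ge0 (ltW C0) (ltW L0); have := ler0n R M.
  by rewrite -[4 * C * L]mulrA; lra.
move=> u B u1 uB; have u0 : 0 < u by apply: lt_le_trans u1.
have u0' := ltW u0.
have row y : (0 < y)%N ->
    `|\sum_(1 <= x < (row_count u y).+1) g y x - rho y * row_length u y|
    <= 4 * (C * (L * u) ^+ 2 + u ^+ 3) * ((L * u + y%:R) ^+ 2)^-1.
  move=> y0; have h0 := row_length_ge0 y u0'; have hm := row_count_le y u0'.
  have hm' := row_count_gt u y; have /andP[r0 r1] := rho01 y.
  have s0 : 0 <= \sum_(1 <= x < (row_count u y).+1) g y x.
    by apply: sumr_ge0 => x _; case/andP: (g01 y x).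
  have s1 : \sum_(1 <= x < (row_count u y).+1) g y x <= (row_count u y)%:R.
    have -> : (row_count u y)%:R = \sum_(1 <= x < (row_count u y).+1) 1 :> R.
      by rewrite sumr_const_nat subn1.
    by apply: ler_sum => x _; case/andP: (g01 y x).
  have := periodic_discrepancy M0 (gx y) (g01 y) (row_count u y).
  rewrite sumrB sumr_const_nat subn1 /= -/(rho y) -[rho y *+ _]mulr_natl.
  move: s0 s1; set S := \sum_(_ <= _ < _) _ => s0 s1 dS.
  have rh : 0 <= rho y * row_length u y <= row_length u y by rewrite mulr_ge0 //= ler_piMl.
  have h2 : row_length u y <= u ^+ 3 / y%:R ^+ 2 by rewrite ge_min lexx orbT.
  apply: le_inv_sqr_majorant => //; [exact: mulr_gt0|exact: ltW| |].
    have hd : `|(row_count u y)%:R * rho y - rho y * row_length u y| <= 1.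
      rewrite mulrC -mulrBr normrM (ger0_norm r0) mulr_ile1 // ler_norml.
      by apply/andP; split; lra.
    have -> : S - rho y * row_length u y = (S - (row_count u y)%:R * rho y) +
       ((row_count u y)%:R * rho y - rho y * row_length u y) by ring.
    by apply: le_trans (ler_normD _ _) (lerD dS hd).
  case/andP: rh => rh0 rh1.
  by rewrite ler_norml; apply/andP; split; lra.
have main := sum_periodic_row_length M0 rhoM rho01 u1 uB.
rewrite mu in main.
have tot : `|region_sum (fun x y => (sqfree_below P (x * y))%:R) B u -
    \sum_(1 <= y < B.+1) rho y * row_length u y| <= 4 * C * L * u + eps * u ^+ 2.
  rewrite /region_sum -sumrB; apply: le_trans (ler_norm_sum _ _ _) _.
  apply: (@le_trans _ _ (\sum_(1 <= y < B.+1)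
      4 * (C * (L * u) ^+ 2 + u ^+ 3) * ((L * u + 1 * y%:R) ^+ 2)^-1)).
    rewrite !big_nat; apply: ler_sum => y /andP[y0 _]; rewrite mul1r; exact: row.
  rewrite -mulr_sumr.
  have Lu0 : 0 < L * u by rewrite mulr_gt0.
  apply: le_trans (ler_wpM2l _ (sum_inv_sqr_le B Lu0 ltr01)) _.
    apply: mulr_ge0 => //; apply: addr_ge0; last exact: exprn_ge0.
    by apply: mulr_ge0; [exact: ltW|exact: sqr_ge0].
  rewrite mul1r le_eqVlt; apply/orP; left; apply/eqP.
  by rewrite /L; field; rewrite !gt_eqF.
set T := region_sum _ _ _ in tot *; set V := \sum_(_ <= _ < _) _ in main tot.
have -> : T - sieve_product P * (3 / 2 * u ^+ 2) =
   (T - V) + (V - sieve_product P * (3 / 2 * u ^+ 2)) by ring.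
apply: le_trans (ler_normD _ _) _; apply: le_trans (lerD tot main) _.
rewrite !mulrDl mul1r; lra.
Qed.

Definition euler_limit : R := \big[*%R/1]_(0 <= p <oo | prime p) euler_factor R p.

Lemma sieve_product_cvg : (sieve_product @ \oo --> euler_limit)%classic.
Proof. exact: euler_product_cvg. Qed.

(** The truncation point Q is chosen first, so that the excess of the truncated
    sieve and the tail of the Euler product are both small. *)
Lemma region_sum_squarefree (eps : R) : 0 < eps -> exists2 K : R, 0 <= K &
  forall u B, 1 <= u -> u ^+ 3 <= B%:R ->
  `|region_sum (fun x y => (squarefree (x * y))%:R) B u
     - 3 / 2 * euler_limit * u ^+ 2| <= eps * u ^+ 2 + K.
Proof.
move=> e0; have e4 : 0 < eps / 4 by rewrite divr_gt0.
have [Q [Q0 hQ hD]] : exists Q, [/\ (0 < Q)%N, 24 / Q%:R <= eps / 4 &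
    `|sieve_product Q.+1 - euler_limit| * (3 / 2) <= eps / 4].
  have /cvgrPdist_le/(_ (eps / 6)) := sieve_product_cvg.
  have -> : 0 < eps / 6 by rewrite divr_gt0.
  move=> /(_ isT) [N _ hN]; pose q := (Num.truncn (96 / eps)).+1.
  exists (q + N)%N; split; first by rewrite addSn.
    have q1 : 96 / eps < (q + N)%:R :> R.
      by rewrite natrD ltr_wpDr ?ler0n // truncnS_gt.
    have q0 : 0 < (q + N)%:R :> R by apply: lt_trans q1; rewrite divr_gt0.
    move: q1; rewrite ltr_pdivrMr // => q1.
    by rewrite ler_pdivrMr //; lra.
  have := hN (q + N).+1; rewrite /= => /(_ (leq_trans (leq_addl q N) (leqnSn _))).
  by rewrite distrC; lra.
have [K K0 hK] := region_sum_sieve Q.+1 e4.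
exists (K ^+ 2 / eps); first exact: divr_ge0 (sqr_ge0 K) (ltW e0).
move=> u B u1 uB; have u0 : 0 < u by apply: lt_le_trans u1.
have h1 := hK u B u1 uB; have /andP[h2 h3] := sieve_excess B Q0 u0.
set T := region_sum _ B u in h1 h2 h3; set S := region_sum _ B u in h2 h3 *.
have u20 : 0 <= u ^+ 2 by rewrite sqr_ge0.
have h4 : T - S <= eps / 4 * u ^+ 2.
  by apply: le_trans h3 _; rewrite mulrAC ler_wpM2r.
have h5 : `|sieve_product Q.+1 * (3 / 2 * u ^+ 2) - 3 / 2 * euler_limit * u ^+ 2|
     <= eps / 4 * u ^+ 2.
  have -> : sieve_product Q.+1 * (3 / 2 * u ^+ 2) - 3 / 2 * euler_limit * u ^+ 2
    = (sieve_product Q.+1 - euler_limit) * (3 / 2) * u ^+ 2 by ring.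
  rewrite normrM (ger0_norm u20) ler_wpM2r //.
  by rewrite normrM (ger0_norm (_ : 0 <= 3 / 2)) // divr_ge0.
(* The linear term is absorbed by completing the square. *)
have h6 : K * u <= eps / 4 * u ^+ 2 + K ^+ 2 / eps.
  rewrite -subr_ge0.
  have -> : eps / 4 * u ^+ 2 + K ^+ 2 / eps - K * u = (eps * u / 2 - K) ^+ 2 / eps.
    by field; rewrite gt_eqF.
  exact: divr_ge0 (sqr_ge0 _) (ltW e0).
move: h1 h5; rewrite !ler_norml => /andP[? ?] /andP[? ?].
by apply/andP; split; lra.
Qed.

End Region.

Local Open Scope classical_set_scope.

(** * Summation over the cube factor *)

Section Count.
Variable R : realType.

Lemma eq_cvgn (f g : nat -> R) (l : R) : f =1 g -> f @ \oo --> l -> g @ \oo --> l.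
Proof. by move=> /funext->. Qed.

Lemma card_smaller_triplesE n :
  #|smaller_triples n| = (\sum_(0 <= z < n.+1) \sum_(0 <= y < n.+1) \sum_(0 <= x < n.+1)
    [&& 0 < x, x <= y, 0 < z, squarefree (x * y) & x * y ^ 2 * z ^ 3 <= n])%N.
Proof.
pose b x y z : nat :=
  [&& 0 < x, x <= y, 0 < z, squarefree (x * y) & x * y ^ 2 * z ^ 3 <= n]%N.
transitivity (\sum_(t : 'I_n.+1 * 'I_n.+1 * 'I_n.+1) b t.1.1 t.1.2 t.2)%N.
  rewrite -sum1_card big_mkcond; apply: eq_bigr => t _.
  by rewrite inE /b; case: ifP.
rewrite -(pair_bigA _ (fun (p : 'I_n.+1 * 'I_n.+1) (z : 'I_n.+1) => b p.1 p.2 z)) /=.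
rewrite -(pair_bigA _ (fun (x y : 'I_n.+1) => \sum_(z < n.+1) b x y z)%N) /=.
under eq_bigr do rewrite exchange_big.
rewrite exchange_big /=; under eq_bigr do rewrite exchange_big.
rewrite big_mkord; apply: eq_bigr => z _; rewrite big_mkord; apply: eq_bigr => y _.
by rewrite big_mkord.
Qed.

Lemma card_smaller_triples_region n (N : R) : 0 < N -> N ^+ 3 = n%:R ->
  #|smaller_triples n|%:R = \sum_(1 <= z < n.+1)
    region_sum (fun x y => (squarefree (x * y))%:R) n (N / z%:R) :> R.
Proof.
move=> N0 N3; rewrite card_smaller_triplesE raddf_sum big_ltn //=.
rewrite [X in X%:R + _]big1 ?add0r; last first.
  by move=> y _; rewrite big1 // => x _; rewrite !andbF.
rewrite !big_nat; apply: eq_bigr => z /andP[z0 zn].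
have z0' : 0 < z%:R :> R by rewrite ltr0n.
have u0 : 0 <= N / z%:R by rewrite divr_ge0 ?ltW.
rewrite raddf_sum big_ltn //= [X in X%:R + _]big1 ?add0r; last first.
  by move=> x _; case: x.
rewrite /region_sum !big_nat; apply: eq_bigr => y /andP[y0 yn].
have ry : (row_count (N / z%:R) y <= n)%N.
  have := leqnn (row_count (N / z%:R) y); rewrite row_countP // => /andP[h _].
  by apply: leq_trans h _; rewrite -ltnS.
rewrite raddf_sum big_ltn //= add0r [RHS](big_nat_widen _ _ n.+1) //= [RHS]big_mkcond /=.
rewrite !big_nat; apply: eq_bigr => x /andP[x0 xn].
rewrite ltnS row_countP // x0 z0 /=.
have -> : ((x * y ^ 2)%N%:R <= (N / z%:R) ^+ 3) = (x * y ^ 2 * z ^ 3 <= n)%N.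
  rewrite expr_div_n N3 ler_pdivlMr ?exprn_gt0 // -natrX -natrM ler_nat.
  by [].
by case: (x <= y)%N; case: squarefree; case: (_ <= n)%N.
Qed.

Lemma region_sum_lt1 F B (u : R) : 0 <= u -> u < 1 -> region_sum F B u = 0.
Proof.
move=> u0 u1; rewrite /region_sum big_nat big1 // => y /andP[y0 _].
suff -> : row_count u y = 0%N by rewrite big_geq.
apply/eqP; rewrite -leqn0 leqNgt row_countP //; apply/negP => /andP[_].
apply/negP; rewrite -ltNge mul1n; apply: lt_le_trans (_ : 1 <= _); first exact: exprn_ilt1.
by rewrite ler1n expn_gt0 y0.
Qed.

(** For z <= N the count of the region for u = N / z is used; for z > N the region
    is empty and the main term itself is the error.  In both cases the error
    besides eps u^2 is at most a multiple of N^2 / (N + z)^2, whose sum is O(N). *)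
Lemma smaller_triples_sum (eps : R) : 0 < eps -> exists2 K : R, 0 <= K &
  forall n (N : R), 0 < N -> N ^+ 3 = n%:R ->
  `|#|smaller_triples n|%:R - 3 / 2 * euler_limit R * N ^+ 2 *
       \sum_(1 <= z < n.+1) (z%:R ^+ 2)^-1|
    <= eps * N ^+ 2 * \sum_(1 <= z < n.+1) (z%:R ^+ 2)^-1 + K * N.
Proof.
move=> e0; have [K K0 hK] := region_sum_squarefree e0.
set c := 3 / 2 * euler_limit R.
exists (4 * (K + `|c|)); first by rewrite mulr_ge0 // addr_ge0.
move=> n N N0 N3; rewrite (card_smaller_triples_region N0 N3).
rewrite mulr_sumr -sumrB mulr_sumr.
apply: le_trans (ler_norm_sum _ _ _) _.
have KC0 : 0 <= 4 * (K + `|c|) by rewrite mulr_ge0 // addr_ge0.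
apply: (@le_trans _ _ (\sum_(1 <= z < n.+1) (eps * N ^+ 2 * (z%:R ^+ 2)^-1 +
     4 * (K + `|c|) * N ^+ 2 * ((N + 1 * z%:R) ^+ 2)^-1))).
  rewrite !big_nat; apply: ler_sum => z /andP[z0 _].
  have z0' : 0 < z%:R :> R by rewrite ltr0n.
  have Nz0 : 0 < N + z%:R by rewrite addr_gt0.
  set u := N / z%:R; have u0 : 0 < u by rewrite divr_gt0.
  have -> : c * N ^+ 2 / z%:R ^+ 2 = c * u ^+ 2.
    by rewrite /u expr_div_n; field; rewrite gt_eqF.
  have -> : eps * N ^+ 2 / z%:R ^+ 2 = eps * u ^+ 2.
    by rewrite /u expr_div_n; field; rewrite gt_eqF.
  rewrite mul1r; set q := (_ ^+ 2)^-1.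
  have q0 : 0 <= N ^+ 2 * q by rewrite mulr_ge0 ?invr_ge0 ?sqr_ge0.
  have qE : N ^+ 2 * q = (N / (N + z%:R)) ^+ 2 by rewrite /q expr_div_n.
  have [u1|u1] := leP 1 u.
    have un : u ^+ 3 <= n%:R.
      rewrite -N3 /u lerXn2r ?nnegrE ?(ltW u0) ?(ltW N0) //.
      by rewrite ler_pdivrMr // ler_peMr ?ler1n // ltW.
    apply: le_trans (hK u n u1 un) _; rewrite lerD2l.
    have h : 1 <= 4 * (N ^+ 2 * q).
      have -> : 4 * (N ^+ 2 * q) = (2 * (N / (N + z%:R))) ^+ 2 by rewrite qE; ring.
      rewrite exprn_ege1 // mulrA ler_pdivlMr // mul1r.
      by move: u1; rewrite /u ler_pdivlMr // mul1r; lra.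
    have h2 := ler_wpM2l K0 h; have h3 : 0 <= `|c| * (4 * (N ^+ 2 * q)).
      by apply: mulr_ge0 => //; apply: mulr_ge0.
    have -> : 4 * (K + `|c|) * N ^+ 2 * q =
      K * (4 * (N ^+ 2 * q)) + `|c| * (4 * (N ^+ 2 * q)) by ring.
    by move: h2; rewrite mulr1; lra.
  rewrite (region_sum_lt1 _ _ (ltW u0) u1) sub0r normrN normrM.
  rewrite (ger0_norm (sqr_ge0 u)).
  have h : u ^+ 2 <= 4 * (N ^+ 2 * q).
    have -> : 4 * (N ^+ 2 * q) = (2 * (N / (N + z%:R))) ^+ 2 by rewrite qE; ring.
    have h0 : 0 <= 2 * (N / (N + z%:R)) by rewrite mulr_ge0 // divr_ge0 ?ltW.
    rewrite lerXn2r ?nnegrE ?(ltW u0) // /u mulrCA ler_pM2l // ler_pdivlMr //.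
    rewrite mulrC ler_pdivrMr //.
    by move: u1; rewrite /u ltr_pdivrMr // mul1r; lra.
  have h2 := ler_wpM2l (normr_ge0 c) h.
  have h3 : 0 <= K * (4 * (N ^+ 2 * q)) by apply: mulr_ge0 => //; apply: mulr_ge0.
  have h4 : 0 <= eps * u ^+ 2 by rewrite mulr_ge0 ?sqr_ge0 // ltW.
  have -> : 4 * (K + `|c|) * N ^+ 2 * q =
      K * (4 * (N ^+ 2 * q)) + `|c| * (4 * (N ^+ 2 * q)) by ring.
  lra.
rewrite big_split /= -!mulr_sumr lerD2l -mulrA ler_wpM2l //.
apply: le_trans (ler_wpM2l (sqr_ge0 N) (sum_inv_sqr_le n N0 ltr01)) _.
by rewrite mul1r expr2 mulfK // gt_eqF.
Qed.

Lemma smaller_triples_density (zeta2 : R) :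
  inv_sqr_sum R @ \oo --> zeta2 ->
  (fun n => #|smaller_triples n|%:R / n%:R `^ (2 / 3)) @ \oo -->
     3 / 2 * euler_limit R * zeta2.
Proof.
move=> hz; set c := 3 / 2 * euler_limit R.
suff h : (fun n => #|smaller_triples n|%:R / n%:R `^ (2 / 3) -
     c * inv_sqr_sum R n) @ \oo --> (0 : R).
  have h' := cvgD h (cvgM (@cvg_cst _ c _ _ _) hz); rewrite add0r in h'.
  by apply: eq_cvgn (h' _ _ _) => n /=; rewrite subrK.
apply/cvgrPdist_le => eps e0.
have e4 : 0 < eps / 4 by rewrite divr_gt0.
have [K K0 hK] := smaller_triples_sum e4.
exists (Num.truncn ((2 * K / eps) ^+ 3)).+1 => // n /= hn.
have n0 : 0 < n%:R :> R by rewrite ltr0n; apply: leq_trans hn.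
pose N : R := n%:R `^ (1 / 3); have N0 : 0 < N by rewrite powR_gt0.
have N3 : N ^+ 3 = n%:R.
  by rewrite -powR_mulrn ?(ltW N0) // -powRrM (_ : 1 / 3 * 3%:R = 1) ?powRr1 ?(ltW n0) //; field.
have N2 : n%:R `^ (2 / 3) = N ^+ 2.
  by rewrite -powR_mulrn ?(ltW N0) // -powRrM; congr (_ `^ _); field.
have KN : 2 * K / eps <= N.
  rewrite leNgt; apply/negP => NK.
  have : N ^+ 3 < (2 * K / eps) ^+ 3.
    by rewrite ltrXn2r // ?nnegrE ?(ltW N0) // ltW // (lt_trans N0 NK).
  rewrite N3 => /lt_le_trans-/(_ _ (ltW (truncnS_gt _))).
  by rewrite ltr_nat ltnNge hn.
rewrite sub0r normrN N2.
have NN : N ^+ 2 != 0 by rewrite gt_eqF // exprn_gt0.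
have := hK n N N0 N3; rewrite -/c -/(inv_sqr_sum R n); set Z := inv_sqr_sum R n; set T := _%:R => h.
have -> : T / N ^+ 2 - c * Z = (T - c * N ^+ 2 * Z) / N ^+ 2 by field; rewrite gt_eqF.
rewrite normrM normfV (ger0_norm (sqr_ge0 N)) ler_pdivrMr ?exprn_gt0 //.
apply: le_trans h _.
have h1 : eps / 4 * N ^+ 2 * Z <= eps / 4 * N ^+ 2 * 2.
  by apply: ler_wpM2l (inv_sqr_sum_le2 R n); apply: mulr_ge0 (ltW e4) (sqr_ge0 N).
have h2 : K * N <= eps / 2 * N ^+ 2.
  move: KN; rewrite ler_pdivrMr // => KN.
  by have := ler_wpM2r (ltW N0) KN; rewrite expr2; lra.
lra.
Qed.

End Count.

(** * The value of zeta(2) *)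

Section Basel.
Variable R : realType.
Implicit Types x : R.

Lemma sin_le_id x : 0 < x -> sin x <= x.
Proof.
move=> x0.
have hc : {within `[0, x], continuous (@sin R)}.
  by apply: continuous_subspaceT; exact: continuous_sin.
have [c _] := MVT x0 (fun y _ => is_derive_sin y) hc.
rewrite sin0 !subr0 => ->; rewrite -[leRHS]mul1r ler_wpM2r ?cos_le1 //.
exact: ltW.
Qed.

(** Equivalent to x <= tan x, which is the mean value theorem for tan. *)
Lemma mulr_cos_le_sin x : 0 < x < pi / 2 -> x * cos x <= sin x.
Proof.
move=> /andP[x0 xpi].
have cpos y : y \in `[0, x]%R -> 0 < cos y.
  rewrite in_itv /= => /andP[y0 yx]; apply: cos_gt0_pihalf.
  by rewrite (le_lt_trans yx xpi) andbT (lt_le_trans _ y0) // oppr_lt0 divr_gt0 ?pi_gt0.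
have hd y : y \in `]0, x[%R -> is_derive y 1 tan ((cos y) ^- 2).
  by move=> /subset_itv_oo_cc/cpos cy; apply: is_derive_tan; exact: lt0r_neq0.
have hc : {within `[0, x], continuous (@tan R)}.
  apply: derivable_within_continuous => y /cpos cy.
  by apply: derivable_tan; exact: lt0r_neq0.
have [c] := MVT x0 hd hc.
move=> /subset_itv_oo_cc/cpos cc.
have cx : 0 < cos x by apply: cpos; rewrite in_itv /= lexx (ltW x0).
rewrite tan0 !subr0 => h; rewrite -ler_pdivlMr // -/(tan x) h.
rewrite -[leLHS]mul1r ler_wpM2r ?(ltW x0) // invf_ge1 ?exprn_gt0 //.
Qed.

(** sin x <= x <= tan x, squared and inverted. *)
Lemma inv_sqr_sandwich x : 0 < x < pi / 2 ->
  (sin x ^+ 2)^-1 - 1 <= (x ^+ 2)^-1 <= (sin x ^+ 2)^-1.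
Proof.
move=> xp; have /andP[x0 _] := xp; have s0 := sin_gt0_pihalf xp.
have sx := sin_le_id x0; have cx := mulr_cos_le_sin xp.
have c0 : 0 < cos x.
  apply: cos_gt0_pihalf; case/andP: xp => _ ->; rewrite andbT.
  by rewrite (lt_trans _ x0) // oppr_lt0 divr_gt0 ?pi_gt0.
have x20 : 0 < x ^+ 2 by rewrite exprn_gt0.
have s20 : 0 < sin x ^+ 2 by rewrite exprn_gt0.
apply/andP; split; last first.
  rewrite lef_pV2 ?posrE // lerXn2r ?nnegrE ?(ltW s0) ?(ltW x0) //.
have h : x ^+ 2 * (1 - sin x ^+ 2) <= sin x ^+ 2.
  rewrite -cos2sin2 -exprMn lerXn2r ?nnegrE ?(ltW s0) //.
  by rewrite mulr_ge0 // ltW.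
rewrite -subr_ge0.
have -> : (x ^+ 2)^-1 - ((sin x ^+ 2)^-1 - 1) =
   (sin x ^+ 2 - x ^+ 2 * (1 - sin x ^+ 2)) / (x ^+ 2 * sin x ^+ 2).
  by field; rewrite !gt_eqF.
by rewrite divr_ge0 ?subr_ge0 // ltW // mulr_gt0.
Qed.

(** Pairs the index k with its reflection, for the substitution of
    pi/2 - t for t. *)
Lemma sum_fold_half (F : nat -> R) m :
  \sum_(0 <= k < m + m) F k = \sum_(0 <= k < m) (F k + F (m + m - k.+1)%N).
Proof.
rewrite (@big_cat_nat _ _ _ m) //= ?leq_addr // big_split /=; congr (_ + _).
rewrite big_nat_rev /= -{1}[m]add0n big_addn addnK.
by apply: eq_bigr => k _; congr (F _); lia.
Qed.

Local Notation inv_sqr_sum := (inv_sqr_sum R).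

Definition odd_angle n k : R := (2 * k + 1)%N%:R * pi / (2 ^ (n + 2))%N%:R.

Lemma odd_angle_itv n k : (k < 2 ^ n)%N -> 0 < odd_angle n k < pi / 2.
Proof.
move=> kn; have d0 : 0 < (2 ^ (n + 2))%N%:R :> R by rewrite ltr0n expn_gt0.
rewrite /odd_angle divr_gt0 ?mulr_gt0 ?pi_gt0 ?ltr0n ?addn1 //=.
rewrite ltr_pdivrMr // mulrC -mulrA ltr_pM2l ?pi_gt0 // mulrC ltr_pdivlMr //.
  by rewrite -natrM ltr_nat expnD; lia.
by rewrite expn_gt0.
Qed.

(** At each doubling the angles t and pi/2 - t are paired, and
    1/sin(t)^2 + 1/cos(t)^2 = 4/sin(2t)^2 multiplies the sum by 4. *)
Lemma sum_inv_sin_sqr n :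
  \sum_(0 <= k < 2 ^ n) (sin (odd_angle n k) ^+ 2)^-1 = 2 * (4 ^ n)%N%:R.
Proof.
elim: n => [|n IH].
  rewrite expn0 big_nat1 /odd_angle mul1r mulr1.
  have -> : pi / (2 ^ (0 + 2))%N%:R = pi / 4 :> R by [].
  have : sin (pi / 4 *+ 2) = 1 :> R.
    transitivity (sin (pi / 2) : R); last exact: sin_pihalf.
    by congr sin; rewrite mulr2n; field.
  rewrite sin_mulr2n => h; have h2 := cos2Dsin2 (pi / 4 : R).
  have t : tan (pi / 4) = 1 :> R := tan_piquarter R.
  have s : sin (pi / 4) = cos (pi / 4) :> R.
    have c0 : cos (pi / 4) != 0 :> R.
      by apply/eqP => c0; move: t; rewrite /tan c0 invr0 mulr0 => /eqP; rewrite eq_sym oner_eq0.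
    by move: t; rewrite /tan => /(canRL (divfK c0)); rewrite mul1r.
  have -> : sin (pi / 4) ^+ 2 = 2^-1 :> R by move: h2; rewrite -s; lra.
  by rewrite invrK.
rewrite [in LHS]expnS mul2n -addnn sum_fold_half expnS natrM mulrCA -IH mulr_sumr.
rewrite !big_nat; apply: eq_bigr => k /andP[_ kn].
have d0 : (2 ^ (n + 2))%N%:R != 0 :> R by rewrite pnatr_eq0 expn_eq0.
set t := odd_angle n.+1 k.
have -> : odd_angle n.+1 (2 ^ n + 2 ^ n - k.+1) = pi / 2 - t.
  have e : (2 * (2 ^ n + 2 ^ n - k.+1) + 1 = 2 ^ (n + 2) - (2 * k + 1))%N.
    by rewrite expnD; lia.
  rewrite /t /odd_angle e natrB; last by rewrite expnD; lia.
  by rewrite addSn expnS natrM; field.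
have tE : odd_angle n k = t *+ 2.
  by rewrite /t /odd_angle addSn expnS natrM; field.
have kn' : (k < 2 ^ n.+1)%N by rewrite expnS; lia.
have t1 := odd_angle_itv kn'; have s0 := sin_gt0_pihalf t1.
have c0 : 0 < cos t.
  apply: cos_gt0_pihalf; case/andP: t1 => t0 ->; rewrite andbT.
  by rewrite (lt_trans _ t0) // oppr_lt0 divr_gt0 ?pi_gt0.
have -> : sin (pi / 2 - t) = cos t.
  by rewrite sinB sin_pihalf cos_pihalf mul1r mul0r subr0.
rewrite tE sin_mulr2n -/t.
have -> : (sin t ^+ 2)^-1 + (cos t ^+ 2)^-1 =
   (cos t ^+ 2 + sin t ^+ 2) / (cos t * sin t) ^+ 2.
  by field; rewrite !gt_eqF.
by rewrite cos2Dsin2; field; rewrite !gt_eqF.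
Qed.

(** The sandwich between 1/sin^2 - 1 and 1/sin^2, applied to the 2^n angles, costs
    2^n out of a total of 2 * 4^n. *)
Lemma sum_inv_odd_sqr_bounds n :
  (pi ^+ 2 / 8 - pi ^+ 2 / 16 / (2 ^ n)%N%:R : R)
    <= \sum_(0 <= k < 2 ^ n) ((2 * k + 1)%N%:R ^+ 2)^-1 <= (pi ^+ 2 / 8 : R).
Proof.
have p0 : 0 < pi :> R by apply: pi_gt0.
set d : R := (2 ^ n)%N%:R; have d0 : 0 < d by rewrite ltr0n expn_gt0.
have d2 : (4 ^ n)%N%:R = d ^+ 2 by rewrite /d -natrX -expnM mulnC expnM.
set O := \sum_(_ <= _ < _) _.
have OE : \sum_(0 <= k < 2 ^ n) (odd_angle n k ^+ 2)^-1 = 16 * d ^+ 2 / pi ^+ 2 * O.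
  rewrite /O mulr_sumr; apply: eq_bigr => k _.
  have k0 : (2 * k + 1)%N%:R != 0 :> R by rewrite pnatr_eq0 addn1.
  rewrite /odd_angle expnD natrM -/d.
  move: k0; set c := (2 * k + 1)%N%:R; move: c => c c0.
  move: (pi : R) p0 => p p0; field.
  by rewrite c0 !gt_eqF.
have SE := sum_inv_sin_sqr n; rewrite d2 in SE.
have h1 : 16 * d ^+ 2 / pi ^+ 2 * O <= 2 * d ^+ 2.
  rewrite -OE -SE !big_nat; apply: ler_sum => k /andP[_ kn].
  by case/andP: (inv_sqr_sandwich (odd_angle_itv kn)).
have h2 : 2 * d ^+ 2 - d <= 16 * d ^+ 2 / pi ^+ 2 * O.
  have dE : \sum_(0 <= k < 2 ^ n) (1 : R) = d by rewrite sumr_const_nat subn0.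
  rewrite -OE -SE -dE -sumrB !big_nat; apply: ler_sum => k /andP[_ kn].
  by case/andP: (inv_sqr_sandwich (odd_angle_itv kn)).
move: h1 h2 p0; clear OE; move: (pi : R) => p h1 h2 p0.
have q0 : 0 < 16 * d ^+ 2 / p ^+ 2 by rewrite divr_gt0 ?mulr_gt0 ?exprn_gt0.
have E : O = p ^+ 2 / (16 * d ^+ 2) * (16 * d ^+ 2 / p ^+ 2 * O).
  by field; rewrite !gt_eqF.
have r0 : 0 <= p ^+ 2 / (16 * d ^+ 2).
  by rewrite divr_ge0 ?exprn_ge0 ?mulr_ge0 ?exprn_ge0 ?(ltW p0) ?(ltW d0).
have E1 : p ^+ 2 / 8 = p ^+ 2 / (16 * d ^+ 2) * (2 * d ^+ 2) by field; rewrite gt_eqF.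
have E2 : p ^+ 2 / 8 - p ^+ 2 / 16 / d = p ^+ 2 / (16 * d ^+ 2) * (2 * d ^+ 2 - d).
  by field; rewrite gt_eqF.
by rewrite E2 {1}E ler_wpM2l //= E E1 ler_wpM2l.
Qed.

Lemma sum_inv_odd_sqr_cvg :
  (fun m => \sum_(0 <= k < m) ((2 * k + 1)%N%:R ^+ 2)^-1) @ \oo --> (pi ^+ 2 / 8 : R).
Proof.
set O := fun m => _.
have Om m n : (m <= n)%N -> O m <= O n :> R.
  move=> mn; rewrite /O (@big_cat_nat _ _ _ m 0 n) //= lerDl.
  by apply: sumr_ge0 => k _; rewrite invr_ge0 sqr_ge0.
apply/cvgrPdist_le => e e0.
have p0 : 0 < pi ^+ 2 / 16 :> R by rewrite divr_gt0 ?exprn_gt0 ?pi_gt0.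
pose n := (Num.truncn (pi ^+ 2 / 16 / e)).+1.
exists (2 ^ n)%N => // m /= nm.
have /andP[_ h2] := sum_inv_odd_sqr_bounds m.
have /andP[h1 _] := sum_inv_odd_sqr_bounds n.
have hm := Om _ _ (ltnW (ltn_expl m (isT : 1 < 2)%N)).
have hn := Om _ _ nm; rewrite -/(O _) in h1 h2.
have : pi ^+ 2 / 16 / (2 ^ n)%N%:R <= e.
  have d0 : 0 < (2 ^ n)%N%:R :> R by rewrite ltr0n expn_gt0.
  rewrite ler_pdivrMr // [e * _]mulrC -ler_pdivrMr //.
  apply: le_trans (ltW (truncnS_gt _)) _; rewrite -/n ler_nat ltnW // ltn_expl //.
move=> he; have mono := le_trans hm h2.
by rewrite ger0_norm ?subr_ge0 //; lra.
Qed.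

Lemma inv_sqr_sum_double m : inv_sqr_sum (m + m) =
  \sum_(0 <= k < m) ((2 * k + 1)%N%:R ^+ 2)^-1 + inv_sqr_sum m / 4.
Proof.
rewrite /inv_sqr_sum; elim: m => [|m IH]; first by rewrite !big_geq // mul0r addr0.
rewrite addSn addnS [LHS]big_nat_recr //= [X in X + _ = _]big_nat_recr //= IH.
rewrite [X in _ = X + _]big_nat_recr //= [X in _ = _ + X / 4]big_nat_recr //=.
have -> : (2 * m + 1 = (m + m).+1)%N by lia.
have -> : ((m + m).+2)%:R = 2 * m.+1%:R :> R by rewrite -natrM; congr _%:R; lia.
have m0 : m.+1%:R != 0 :> R by rewrite pnatr_eq0.
have m1 : (m + m).+1%:R != 0 :> R by rewrite pnatr_eq0.
move: (m.+1%:R : R) m0 ((m + m).+1%:R : R) m1 => a a0 b b0.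
by field; rewrite a0 b0.
Qed.

(** Splitting off the even terms gives zeta(2) = pi^2/8 + zeta(2)/4. *)
Lemma basel : inv_sqr_sum @ \oo --> (pi ^+ 2 / 6 : R).
Proof.
have cv : cvgn inv_sqr_sum.
  apply: nondecreasing_is_cvgn; first by move=> m n; apply: inv_sqr_sum_mono.
  by exists 2 => _ [n _ <-]; apply: inv_sqr_sum_le2.
set l := limn inv_sqr_sum in cv *.
have cv2 : (fun m => inv_sqr_sum (m + m)) @ \oo --> l.
  apply: (cvg_comp (fun m => m + m)%N inv_sqr_sum) cv.
  by move=> A [N _ hN]; exists N => // m /= Nm; apply: hN => /=; lia.
have cv3 : (fun m => inv_sqr_sum (m + m)) @ \oo --> pi ^+ 2 / 8 + l / 4.
  have h := cvgD sum_inv_odd_sqr_cvg (cvgM cv (@cvg_cst _ (4^-1 : R) _ _ _)).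
  by apply: eq_cvgn (h _ _ _) => m /=; rewrite inv_sqr_sum_double.
have e : l = pi ^+ 2 / 8 + l / 4 by apply: (cvg_unique _ cv2 cv3).
suff -> : pi ^+ 2 / 6 = l by [].
move: e; move: (pi ^+ 2) => q e; lra.
Qed.

End Basel.

(** * The Euler product of zeta(2) and the accelerated product for C3 *)

Definition rough (P z : nat) : bool :=
  all (fun p => ~~ (p %| z)%N) [seq p <- iota 0 P | prime p].

Lemma roughS P z : rough P.+1 z = rough P z && (prime P ==> ~~ (P %| z)%N).
Proof.
rewrite /rough -[P.+1]addn1 iotaD filter_cat all_cat add0n /=.
by case: (prime P) => //=; rewrite andbT.
Qed.

Lemma rough1 P : rough P 1.
Proof. by apply/allP => p; rewrite mem_filter dvdn1 => /andP[/prime_gt1]; case: p => [|[]]. Qed.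

Lemma rough_ge P z : (1 < z)%N -> rough P z -> (P <= z)%N.
Proof.
move=> z1 /allP h; rewrite leqNgt; apply/negP => zP.
have pz := pdiv_leq (ltnW z1).
have := h (pdiv z); rewrite pdiv_dvd mem_filter pdiv_prime // mem_iota /= add0n.
by rewrite (leq_ltn_trans pz zP) => /(_ isT).
Qed.

Lemma rough_primeM P j : prime P -> rough P (P * j) = rough P j.
Proof.
move=> pP; rewrite /rough; apply: eq_in_all => p.
rewrite mem_filter mem_iota /= add0n => /andP[pp pltP].
by rewrite Euclid_dvdM // dvdn_prime2 // ltn_eqF.
Qed.

Section Rough.
Variable R : realType.

Definition rough_sum P n : R := \sum_(1 <= z < n.+1 | rough P z) (z%:R ^+ 2)^-1.

(** Passing from P to P + 1 removes the multiples of P when P is prime; a multiple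
    P j has no prime factor below P exactly when j has none. *)
Lemma rough_sumS P n : rough_sum P.+1 n =
  rough_sum P n - (if prime P then rough_sum P (n %/ P) / P%:R ^+ 2 else 0).
Proof.
case: (boolP (prime P)) => [pP|nP]; last first.
  by rewrite subr0; apply: eq_bigl => z; rewrite roughS (negPf nP) andbT.
have -> : rough_sum P (n %/ P) / P%:R ^+ 2 =
    \sum_(1 <= z < n.+1 | (P %| z)%N) (if rough P z then (z%:R ^+ 2)^-1 else 0).
  rewrite sum_multiples ?prime_gt0 // /rough_sum big_mkcond mulr_suml.
  apply: eq_bigr => j _; rewrite rough_primeM //; case: ifP => _; last by rewrite mul0r.
  by rewrite natrM exprMn [RHS]invfM mulrC.
rewrite /rough_sum big_mkcond [X in _ = X - _]big_mkcond [X in _ = _ - X]big_mkcond -sumrB.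
apply: eq_bigr => z _; rewrite roughS pP /=.
by case: (rough P z); case: (P %| z)%N; rewrite /= ?subrr ?subr0.
Qed.

Definition inv_zeta_product P : R := \prod_(0 <= p < P | prime p) (1 - (p%:R ^+ 2)^-1).

Lemma inv_zeta_productS P : inv_zeta_product P.+1 =
  inv_zeta_product P * (if prime P then 1 - (P%:R ^+ 2)^-1 else 1).
Proof. by rewrite /inv_zeta_product big_mkcond big_nat_recr //= -big_mkcond. Qed.

Lemma rough_sum_cvg P :
  rough_sum P @ \oo --> pi ^+ 2 / 6 * inv_zeta_product P.
Proof.
elim: P => [|P IH].
  by rewrite /inv_zeta_product big_geq // mulr1; exact: basel.
rewrite inv_zeta_productS.
case: (boolP (prime P)) => pP; last first.
  rewrite mulr1; apply: eq_cvgn IH => n.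
  by rewrite rough_sumS (negPf pP) subr0.
have IH2 : (fun n => rough_sum P (n %/ P)) @ \oo --> pi ^+ 2 / 6 * inv_zeta_product P.
  apply: (cvg_comp (fun n => n %/ P)%N (rough_sum P)) IH.
  move=> A [N _ hN]; exists (N * P)%N => // n /= Nn; apply: hN => /=.
  by rewrite leq_divRL // prime_gt0.
have h := cvgB IH (cvgM IH2 (@cvg_cst _ ((P%:R ^+ 2)^-1 : R) _ _ _)).
rewrite mulrA mulrBr mulr1.
by apply: eq_cvgn (h _ _ _) => n /=; rewrite rough_sumS pP.
Qed.

Lemma rough_sum_bounds Q n : (0 < Q)%N -> (0 < n)%N ->
  1 <= rough_sum Q.+1 n <= 1 + Q%:R^-1.
Proof.
move=> Q0 n0; rewrite /rough_sum big_mkcond big_ltn //= rough1 expr1n invr1.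
apply/andP; split.
  rewrite lerDl; apply: sumr_ge0 => z _; by case: ifP.
rewrite lerD2l; apply: le_trans (sum_inv_sqr_tail R n.+1 Q0).
have [nQ|Qn] := leqP n.+1 Q.+1.
  rewrite [leRHS]big_geq // big_nat big1 // => z /andP[z1 zn].
  case: ifP => // /(rough_ge z1) Qz; have := leq_trans zn nQ; lia.
rewrite (@big_cat_nat _ _ _ Q.+1) //=; last exact: ltnW.
rewrite big_nat big1 ?add0r; last first.
  by move=> z /andP[z1 zQ]; case: ifP => // /(rough_ge z1); lia.
by apply: ler_sum => z _; case: ifP => // _; rewrite invr_ge0 sqr_ge0.
Qed.

(** The Euler product of zeta(2): zeta(2) times the product of the 1 - 1/p^2 over
    p < P is the sum of 1/z^2 over the z without prime factor below P, namely
    z = 1 and some z >= P. *)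
Lemma inv_zeta_product_cvg :
  (fun P => pi ^+ 2 / 6 * inv_zeta_product P) @ \oo --> (1 : R).
Proof.
have bnd Q : (0 < Q)%N -> 1 <= pi ^+ 2 / 6 * inv_zeta_product Q.+1 <= 1 + (Q%:R : R)^-1.
  move=> Q0; have cv := rough_sum_cvg (P := Q.+1).
  rewrite -(cvg_lim _ cv) //; apply/andP; split.
    apply: limr_ge; first by apply/cvg_ex; eexists; exact: cv.
    by exists 1%N => // n /= n0; case/andP: (rough_sum_bounds Q0 n0).
  apply: limr_le; first by apply/cvg_ex; eexists; exact: cv.
  by exists 1%N => // n /= n0; case/andP: (rough_sum_bounds Q0 n0).
apply/cvgrPdist_le => e e0.
pose q := (Num.truncn e^-1).+1.
exists q.+1 => // -[//|P] /= qP.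
have qP' : (q <= P)%N by [].
have P0 : (0 < P)%N by apply: leq_trans qP'.
have /andP[h1 h2] := bnd P P0.
rewrite distrC ger0_norm ?subr_ge0 // lerBlDl; apply: le_trans h2 _.
rewrite lerD2l -[leRHS]invrK lef_pV2 ?posrE ?invr_gt0 ?ltr0n //.
apply: le_trans (ltW (truncnS_gt _)) _; rewrite ler_nat.
by [].
Qed.

(** The factor 1 + cubic_excess p is the quotient of the Euler factor at p by
    (1 - 1/p^2)^3. *)
Definition cubic_excess (p : nat) : R :=
  (2 * p%:R + 1) / ((p%:R - 1) * (p%:R + 1) ^+ 3).

Definition ratio_product P : R := \prod_(0 <= p < P | prime p) (1 + cubic_excess p).

Lemma cubic_excess_ge0 p : (1 < p)%N -> 0 <= cubic_excess p.
Proof.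
move=> p1; have h : 1 <= p%:R :> R by rewrite ler1n ltnW.
apply: divr_ge0; first by lra.
by apply: mulr_ge0; [lra|apply: exprn_ge0; lra].
Qed.

Lemma euler_factorE p : (1 < p)%N ->
  euler_factor R p = (1 - (p%:R ^+ 2)^-1) ^+ 3 * (1 + cubic_excess p).
Proof.
move=> p1; have h : 2 <= p%:R :> R by rewrite ler_nat.
rewrite /euler_factor /cubic_excess; move: (p%:R : R) h => x h.
have [x0 x1 x2] : [/\ x != 0, x - 1 != 0 & x + 1 != 0].
  by split; apply: lt0r_neq0; lra.
by field; rewrite x0 x1 x2.
Qed.

Lemma sieve_productE P : sieve_product R P = inv_zeta_product P ^+ 3 * ratio_product P.
Proof.
rewrite /sieve_product /inv_zeta_product /ratio_product -prodrXl -big_split /=.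
by apply: eq_bigr => p /prime_gt1; apply: euler_factorE.
Qed.

Lemma ratio_productS P : ratio_product P.+1 =
  ratio_product P * (if prime P then 1 + cubic_excess P else 1).
Proof. by rewrite /ratio_product big_mkcond big_nat_recr //= -big_mkcond. Qed.

Lemma ratio_product_gt0 P : 0 < ratio_product P.
Proof.
apply: prodr_gt0 => p /prime_gt1/cubic_excess_ge0; lra.
Qed.

Lemma ratio_product_cvg : ratio_product @ \oo --> (pi ^+ 2 / 6) ^+ 3 * euler_limit R.
Proof.
have z0 : (pi ^+ 2 / 6 : R) != 0 by rewrite gt_eqF // divr_gt0 ?exprn_gt0 ?pi_gt0.
have i0 P : inv_zeta_product P != 0.
  rewrite gt_eqF // prodr_gt0 // => p /prime_gt1 p1.
  rewrite subr_gt0 invf_lt1 ?exprn_gt0 ?ltr0n ?(ltnW p1) //.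
  by rewrite exprn_egt1 ?ltr1n.
have c1 := inv_zeta_product_cvg.
pose zb P : R := pi ^+ 2 / 6 * inv_zeta_product P.
have c3 : (fun P => zb P * zb P * zb P) @ \oo --> (1 * 1 * 1 : R).
  exact: cvgM (cvgM c1 c1) c1.
rewrite !mulr1 in c3.
have h : (fun P => (pi ^+ 2 / 6) ^+ 3 * (sieve_product R P * (zb P * zb P * zb P)^-1)) @ \oo
    --> ((pi ^+ 2 / 6) ^+ 3 * (euler_limit R * 1^-1) : R).
  apply: cvgM; first exact: cvg_cst.
  by apply: cvgM; [exact: sieve_product_cvg|apply: cvgV].
rewrite invr1 mulr1 in h.
apply: eq_cvgn h => P.
rewrite sieve_productE /zb; move: (pi ^+ 2 / 6 : R) z0 (i0 P) => z z0.
by move: (inv_zeta_product P) => b b0; field; rewrite z0 b0.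
Qed.

(** The correction 1/((P-1) P) is the tail of the telescoping series with terms
    2/((m-1) m (m+1)), and these exceed cubic_excess m with enough room to absorb
    the products of two corrections. *)
Lemma ratio_product_tail P : (1 < P)%N ->
  ratio_product P.+1 * (1 + (P%:R * (P%:R + 1))^-1)
    <= ratio_product P * (1 + ((P%:R - 1) * P%:R)^-1).
Proof.
move=> P1; rewrite ratio_productS -mulrA ler_pM2l ?ratio_product_gt0 //.
have h : 2 <= P%:R :> R by rewrite ler_nat.
have e0 := cubic_excess_ge0 P1.
apply: (@le_trans _ _ ((1 + cubic_excess P) * (1 + (P%:R * (P%:R + 1))^-1))).
  have g0 : 0 <= 1 + (P%:R * (P%:R + 1))^-1 :> R.
    by rewrite addr_ge0 // invr_ge0; apply: mulr_ge0; lra.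
  by apply: ler_wpM2r => //; case: ifP => _ //; lra.
rewrite /cubic_excess -subr_ge0; move: (P%:R : R) h => x h.
have [x0 x1 x2] : [/\ 0 < x, 0 < x - 1 & 0 < x + 1] by split; lra.
have -> : 1 + ((x - 1) * x)^-1 - (1 + (2 * x + 1) / ((x - 1) * (x + 1) ^+ 3)) *
    (1 + (x * (x + 1))^-1) =
    (2 * (x + 1) ^+ 3 - (2 * x + 1) * (x * (x + 1) + 1)) / (x * (x - 1) * (x + 1) ^+ 4).
  by field; rewrite !gt_eqF.
apply: divr_ge0.
  have -> : 2 * (x + 1) ^+ 3 - (2 * x + 1) * (x * (x + 1) + 1) = 3 * x ^+ 2 + 3 * x + 1 by ring.
  by have := sqr_ge0 x; lra.
by rewrite ltW // !mulr_gt0 ?exprn_gt0.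
Qed.

Lemma ratio_product_limit_bounds P : (1 < P)%N ->
  ratio_product P <= (pi ^+ 2 / 6) ^+ 3 * euler_limit R
    <= ratio_product P * (1 + ((P%:R - 1) * P%:R)^-1).
Proof.
move=> P1; have cv := ratio_product_cvg.
rewrite -(cvg_lim _ cv) //; apply/andP; split.
  apply: limr_ge; first by apply/cvg_ex; eexists; exact: cv.
  exists P => // n /= Pn; rewrite -(subnKC Pn); elim: (n - P)%N => [|k IH].
    by rewrite addn0.
  apply: le_trans IH _; rewrite addnS ratio_productS ler_peMr ?(ltW (ratio_product_gt0 _)) //.
  by case: ifP => // /prime_gt1/cubic_excess_ge0; lra.
apply: limr_le; first by apply/cvg_ex; eexists; exact: cv.
exists P => // n /= Pn.
suff h : ratio_product n * (1 + ((n%:R - 1) * n%:R)^-1) <=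
         ratio_product P * (1 + ((P%:R - 1) * P%:R)^-1).
  apply: le_trans h; rewrite ler_peMr ?(ltW (ratio_product_gt0 _)) // lerDl invr_ge0.
  have : 1 <= n%:R :> R by rewrite ler1n (leq_trans (ltnW P1)).
  by move=> n1; apply: mulr_ge0; lra.
rewrite -(subnKC Pn); elim: (n - P)%N => [|k IH]; first by rewrite addn0.
apply: le_trans IH; rewrite addnS.
have := @ratio_product_tail (P + k) (leq_trans P1 (leq_addr _ _)).
by rewrite -[(P + k).+1%:R]natr1 addrK.
Qed.

End Rough.

(** * Decimals of C3 *)

Section ZetaBounds.
Variable R : realType.

(** 1/z^2 <= 1/(z - 1/2) - 1/(z + 1/2). *)
Lemma zeta2_le K : pi ^+ 2 / 6 <= inv_sqr_sum R K + (K%:R + 2^-1)^-1.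
Proof.
have cv := @basel R; rewrite -(cvg_lim _ cv) //.
apply: limr_le; first by apply/cvg_ex; eexists; exact: cv.
exists K => // n /= Kn.
suff h : inv_sqr_sum R n + (n%:R + 2^-1)^-1 <= inv_sqr_sum R K + (K%:R + 2^-1)^-1.
  by apply: le_trans h; rewrite lerDl invr_ge0 addr_ge0 ?ler0n ?invr_ge0.
rewrite -(subnKC Kn); elim: (n - K)%N => [|k IH]; first by rewrite addn0.
apply: le_trans IH; rewrite addnS /inv_sqr_sum big_nat_recr //= -[(K + k).+1%:R]natr1.
rewrite -addrA lerD2l; have : 0 <= (K + k)%:R :> R by rewrite ler0n.
move: (_%:R : R) => x x0; rewrite -subr_ge0.
have [x1 x2 x3] : [/\ 0 < x + 1, 0 < 2 * x + 1 & 0 < 2 * x + 3] by split; lra.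
have -> : (x + 2^-1)^-1 - (((x + 1) ^+ 2)^-1 + (x + 1 + 2^-1)^-1) =
    ((2 * x + 1) * (2 * x + 3) * (x + 1) ^+ 2)^-1.
  by field; rewrite !gt_eqF //; lra.
by rewrite invr_ge0 ltW // !mulr_gt0 ?exprn_gt0.
Qed.

(** With e = 1/(8 K), 1/z^2 >= 1/(z - 1/2 + e) - 1/(z + 1/2 + e) for z > K, because
    (z + e)^2 - 1/4 >= z^2. *)
Lemma zeta2_ge K : (0 < K)%N ->
  inv_sqr_sum R K + (K%:R + 2^-1 + (8 * K%:R)^-1)^-1 <= pi ^+ 2 / 6.
Proof.
move=> K0; have cv := @basel R; set e : R := (8 * K%:R)^-1.
have K1 : 0 < K%:R :> R by rewrite ltr0n.
have e0 : 0 < e by rewrite invr_gt0 mulr_gt0.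
have Ke : 8 * K%:R * e = 1 by rewrite /e mulfV // gt_eqF // mulr_gt0.
have le_lim n : inv_sqr_sum R n <= pi ^+ 2 / 6.
  rewrite -(cvg_lim _ cv) //; apply: limr_ge; first by apply/cvg_ex; eexists; exact: cv.
  by exists n => // m /=; apply: inv_sqr_sum_mono.
have mono n : (K <= n)%N -> inv_sqr_sum R K + (K%:R + 2^-1 + e)^-1 <=
    inv_sqr_sum R n + (n%:R + 2^-1 + e)^-1.
  move=> Kn; rewrite -(subnKC Kn); elim: (n - K)%N => [|k IH]; first by rewrite addn0.
  apply: le_trans IH _; rewrite addnS /inv_sqr_sum [in leRHS]big_nat_recr //=.
  rewrite -[(K + k).+1%:R]natr1.
  rewrite -[leRHS]addrA lerD2l; have : K%:R <= (K + k)%:R :> R by rewrite ler_nat leq_addr.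
  move: ((K + k)%:R : R) => x xK; rewrite -subr_ge0.
  have [x1 x2 x3] : [/\ 0 < x + 1, 0 < 2 * x + 1 + 2 * e & 0 < 2 * x + 3 + 2 * e] by split; lra.
  have -> : ((x + 1) ^+ 2)^-1 + (x + 1 + 2^-1 + e)^-1 - (x + 2^-1 + e)^-1 =
     (8 * (x + 1) * e + 4 * e ^+ 2 - 1) /
       ((2 * x + 1 + 2 * e) * (2 * x + 3 + 2 * e) * (x + 1) ^+ 2).
    by field; rewrite !gt_eqF //; lra.
  apply: divr_ge0; last by rewrite ltW // !mulr_gt0 ?exprn_gt0.
  have := sqr_ge0 e; have : 8 * K%:R * e <= 8 * (x + 1) * e by rewrite ler_wpM2r ?(ltW e0) //; lra.
  lra.
apply/ler_addgt0Pr => d d0.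
pose n := maxn K (Num.truncn d^-1).+1.
apply: le_trans (mono n (leq_maxl _ _)) _; apply: lerD => //.
have dn : d^-1 < n%:R.
  by apply: lt_le_trans (truncnS_gt _) _; rewrite ler_nat leq_maxr.
have dp : 0 < d^-1 by rewrite invr_gt0.
rewrite -[leRHS]invrK lef_pV2 ?posrE //; last by lra.
lra.
Qed.

End ZetaBounds.

Local Delimit Scope N_scope with BN.

(** Real numbers are represented by integers, in units of 10^(-15). *)
Definition scale : BinNums.N := (10 ^ 15)%BN.

Fixpoint zeta2_floor (K : nat) : BinNums.N :=
  if K is k.+1 then (zeta2_floor k + scale / BinNat.N.of_nat K ^ 2)%BN else 0%BN.

(** Each factor 1 + cubic_excess p is the fraction p^3 (p + 2) / ((p - 1) (p + 1)^3);
    the lower bound is rounded down and the upper bound up. *)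
Fixpoint ratio_product_bounds (P : nat) : BinNums.N * BinNums.N :=
  if P is p.+1 then
    let: (lo, up) := ratio_product_bounds p in
    if prime p then
      let q := BinNat.N.of_nat p in
      let num := (q ^ 3 * (q + 2))%BN in
      let den := (BinNat.N.pred q * (q + 1) ^ 3)%BN in
      ((lo * num / den)%BN, (up * num / den + 1)%BN)
    else (lo, up)
  else (scale, scale).

Section Numerics.
Variable R : realType.

Definition ofN (a : BinNums.N) : R := (BinNat.N.to_nat a)%:R.

Lemma ofN_add a b : ofN (a + b)%BN = ofN a + ofN b.
Proof. by rewrite /ofN Nnat.N2Nat.inj_add -natrD. Qed.

Lemma ofN_mul a b : ofN (a * b)%BN = ofN a * ofN b.
Proof. by rewrite /ofN Nnat.N2Nat.inj_mul -natrM. Qed.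

Lemma ofN_exp a k : ofN (a ^ BinNat.N.of_nat k)%BN = ofN a ^+ k.
Proof.
elim: k => [|k IH]; first by [].
by rewrite Nnat.Nat2N.inj_succ BinNat.N.pow_succ_r' ofN_mul IH exprS.
Qed.

Lemma ofN_of_nat k : ofN (BinNat.N.of_nat k) = k%:R.
Proof. by rewrite /ofN Nnat.Nat2N.id. Qed.

Lemma ofN1 : ofN 1%BN = 1. Proof. by []. Qed.

Lemma ofN_ge0 a : 0 <= ofN a. Proof. exact: ler0n. Qed.

Lemma ofN_le a b : (a <=? b)%BN -> ofN a <= ofN b.
Proof. by move=> /BinNat.N.leb_le h; rewrite /ofN ler_nat; lia. Qed.

Lemma ofN_lt a b : (a <? b)%BN -> ofN a < ofN b.
Proof. by move=> /BinNat.N.ltb_lt h; rewrite /ofN ltr_nat; lia. Qed.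

Lemma ofN_div a b : 0 < ofN b ->
  ofN (a / b)%BN <= ofN a / ofN b < ofN (a / b)%BN + 1.
Proof.
move=> b0; have bn0 : b <> 0%BN by move=> b0'; rewrite b0' ltxx in b0.
rewrite ler_pdivlMr // ltr_pdivrMr // -ofN1 -ofN_add -!ofN_mul.
rewrite [ofN _ <= _]ofN_le ?ofN_lt //.
  by apply/BinNat.N.ltb_lt; have := BinNat.N.mul_succ_div_gt a b bn0; lia.
by apply/BinNat.N.leb_le; have := BinNat.N.mul_div_le a b bn0; lia.
Qed.

Lemma scale_gt0 : 0 < ofN scale.
Proof. exact: (@ofN_lt 0%BN). Qed.

(* The casts of large integers must not be unfolded to unary numbers. *)
#[local] Opaque ofN.

Lemma zeta2_floorP K :
  ofN (zeta2_floor K) <= ofN scale * inv_sqr_sum R K <= ofN (zeta2_floor K) + K%:R.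
Proof.
elim: K => [|k /andP[IH1 IH2]].
  by rewrite /inv_sqr_sum big_geq // mulr0 addr0 lexx.
rewrite [zeta2_floor _]/= ofN_add /inv_sqr_sum big_nat_recr //= -/(inv_sqr_sum R k) mulrDr.
have E : ofN (BinNat.N.of_nat k.+1 ^ 2)%BN = k.+1%:R ^+ 2.
  by rewrite -(ofN_of_nat k.+1) -ofN_exp.
have := @ofN_div scale (BinNat.N.of_nat k.+1 ^ 2)%BN; rewrite E exprn_gt0 ?ltr0n //.
move=> /(_ isT)/andP[h1 h2]; rewrite -[X in _ <= _ + _ + X]natr1 addrACA.
by rewrite !lerD // ltW.
Qed.

Lemma ratio_product_boundsP P :
  ofN (ratio_product_bounds P).1 <= ofN scale * ratio_product R P
    <= ofN (ratio_product_bounds P).2.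
Proof.
elim: P => [|p]; first by rewrite /ratio_product big_geq // mulr1 lexx.
rewrite ratio_productS [ratio_product_bounds p.+1]/=.
case: ratio_product_bounds => lo up; rewrite [(_, _).1]/= [(_, _).2]/=.
move: (ofN scale) (ratio_product R p) => s r /andP[h1 h2].
case: (boolP (prime p)) => [pp|_]; last by rewrite mulr1 h1.
have p1 := prime_gt1 pp.
have [p2 m1 a1 a2] : [/\ 2 <= p%:R :> R, 0 < p%:R - 1 :> R, 0 < p%:R + 1 :> R & 0 < p%:R + 2 :> R].
  have h : 2 <= p%:R :> R by rewrite ler_nat.
  by move: h; clear; split; lra.
set q := BinNat.N.of_nat p; set num := (_ ^ 3 * _)%BN; set den := (_ * _ ^ 3)%BN.
have qE : ofN q = p%:R := ofN_of_nat p.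
have predE : ofN (BinNat.N.pred q) = p%:R - 1.
  have e : ofN (BinNat.N.pred q) + 1 = p%:R.
    by rewrite -ofN1 -ofN_add -qE; congr ofN; rewrite /q; lia.
  by rewrite -e addrK.
have numE : ofN num = p%:R ^+ 3 * (p%:R + 2).
  by rewrite /num ofN_mul ofN_add qE (ofN_exp _ 3) qE.
have denE : ofN den = (p%:R - 1) * (p%:R + 1) ^+ 3.
  by rewrite /den ofN_mul predE (ofN_exp _ 3) ofN_add qE.
have den0 : 0 < ofN den by rewrite denE; apply: mulr_gt0 => //; apply: exprn_gt0.
have num0 : 0 < ofN num.
  by rewrite numE; apply: mulr_gt0 => //; apply: exprn_gt0; apply: lt_le_trans p2.
have tE : 1 + cubic_excess R p = ofN num / ofN den.
  rewrite /cubic_excess numE denE; move: (p%:R : R) m1 a1 => x m1 a1; clear -m1 a1.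
  by field; rewrite !gt_eqF.
have c0 : 0 <= ofN num / ofN den by rewrite divr_ge0 ?ltW.
have /andP[d1 _] := ofN_div (lo * num)%BN den0.
have /andP[_ d2] := ofN_div (up * num)%BN den0.
rewrite tE mulrA; apply/andP; split.
  apply: le_trans d1 _; rewrite ofN_mul -mulrA; exact: ler_wpM2r.
rewrite ofN_add ofN1; apply: le_trans _ (ltW d2); rewrite ofN_mul -[leRHS]mulrA; exact: ler_wpM2r.
Qed.

(** The bound of zeta2_le in units of 1/scale, rounded upwards: each term of
    zeta2_floor loses less than 1, hence the summand K. *)
Definition zeta2_upper (K : nat) : BinNums.N :=
  (zeta2_floor K + BinNat.N.of_nat K + (2 * scale / (2 * BinNat.N.of_nat K + 1) + 1))%BN.

Definition zeta2_lower (K : nat) : BinNums.N :=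
  let k := BinNat.N.of_nat K in
  (zeta2_floor K + scale * (8 * k) / (8 * k ^ 2 + 4 * k + 1))%BN.

Lemma zeta2_upperP K : ofN scale * (pi ^+ 2 / 6) <= ofN (zeta2_upper K).
Proof.
have /andP[_ h] := zeta2_floorP K.
have t := ler_wpM2l (ltW scale_gt0) (zeta2_le R K).
apply: le_trans t _; rewrite mulrDr /zeta2_upper 2!ofN_add ofN_of_nat; apply: lerD => //.
rewrite ofN_add ofN1.
have dE : ofN (2 * BinNat.N.of_nat K + 1)%BN = 2 * K%:R + 1.
  by rewrite ofN_add ofN_mul ofN_of_nat ofN1 (ofN_of_nat 2).
have K0 : 0 <= K%:R :> R by rewrite ler0n.
have d0 : 0 < ofN (2 * BinNat.N.of_nat K + 1)%BN.
  by rewrite dE; move: K0; clear; lra.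
have /andP[_ d2] := ofN_div (2 * scale)%BN d0.
apply: le_trans _ (ltW d2); rewrite dE ofN_mul (ofN_of_nat 2).
move: (ofN scale) (K%:R : R) K0 => s k k0; clear -k0.
by rewrite le_eqVlt; apply/orP; left; apply/eqP; field; rewrite !gt_eqF //; lra.
Qed.

Lemma zeta2_lowerP K : (0 < K)%N -> ofN (zeta2_lower K) <= ofN scale * (pi ^+ 2 / 6).
Proof.
move=> K0; have /andP[h _] := zeta2_floorP K.
apply: le_trans (ler_wpM2l (ltW scale_gt0) (zeta2_ge R K0)).
rewrite mulrDr /zeta2_lower ofN_add; apply: lerD => //.
have K1 : 0 < K%:R :> R by rewrite ltr0n.
set den := (_ + 1)%BN.
have dE : ofN den = 8 * K%:R ^+ 2 + 4 * K%:R + 1.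
  rewrite /den !ofN_add !ofN_mul (ofN_exp _ 2) ofN_of_nat ofN1.
  by rewrite (ofN_of_nat 8) (ofN_of_nat 4).
have d0 : 0 < ofN den.
  by rewrite dE; move: (sqr_ge0 (K%:R : R)) K1; clear; lra.
have /andP[d1 _] := ofN_div (scale * (8 * BinNat.N.of_nat K))%BN d0.
apply: le_trans d1 _; rewrite dE !ofN_mul ofN_of_nat (ofN_of_nat 8).
move: (ofN scale) (K%:R : R) K1 => s k k0; clear -k0.
have k2 : 0 < k ^+ 2 by rewrite exprn_gt0.
by rewrite le_eqVlt; apply/orP; left; apply/eqP; field; rewrite !gt_eqF //; lra.
Qed.

Lemma C3E : C3 R = 3 / 2 * ((pi ^+ 2 / 6) ^+ 3 * euler_limit R) / (pi ^+ 2 / 6) ^+ 2.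
Proof.
have p0 : 0 < pi ^+ 2 :> R by rewrite exprn_gt0 ?pi_gt0.
rewrite /C3 -/(euler_limit R); move: (pi ^+ 2 : R) p0 => q q0.
by field; rewrite gt_eqF.
Qed.

(** C3 = 3/2 X / zeta(2)^2 with X the accelerated product, so that a lower bound of
    X and an upper bound of zeta(2) reduce the claim to an inequality between
    integers, to be decided by computation. *)
Lemma C3_ge (a b : BinNums.N) K P : (1 < P)%N -> (0 <? b)%BN ->
  (2 * a * zeta2_upper K ^ 2 <=? 3 * b * (ratio_product_bounds P).1 * scale)%BN ->
  ofN a / ofN b <= C3 R.
Proof.
move=> P1 /ofN_lt b0 /ofN_le.
rewrite !ofN_mul (ofN_exp _ 2) (ofN_of_nat 2) (ofN_of_nat 3).
have z0 : 0 < pi ^+ 2 / 6 :> R by rewrite divr_gt0 ?exprn_gt0 ?pi_gt0.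
have zA := zeta2_upperP K; have /andP[lr _] := ratio_product_boundsP P.
have /andP[rX _] := ratio_product_limit_bounds R P1.
have s0 := scale_gt0; rewrite C3E.
move: (ofN_ge0 a) (ofN_ge0 (ratio_product_bounds P).1) b0.
move: (ofN a) (ofN b) (ofN scale) (ofN (zeta2_upper K)) (ofN (ratio_product_bounds P).1)
  (pi ^+ 2 / 6) (ratio_product R P) (euler_limit R) z0 zA lr rX s0
  => x y s A lo z r D z0 zA lr rX s0 x0 lo0 y0; set X := z ^+ 3 * D => h.
have y0' : 0 < y := y0.
rewrite ler_pdivrMr // [leRHS]mulrAC ler_pdivlMr ?exprn_gt0 //.
have s2 : 0 < s ^+ 2 by rewrite exprn_gt0.
rewrite -(ler_pM2l s2).
have h1 : x * (s * z) ^+ 2 <= x * A ^+ 2.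
  apply: ler_wpM2l => //; rewrite lerXn2r ?nnegrE //; first by rewrite mulr_ge0 ?ltW.
  by apply: le_trans zA; rewrite mulr_ge0 ?ltW.
have h2 : y * s * lo <= y * s * (s * X).
  apply: ler_wpM2l; first by rewrite mulr_ge0 ?ltW.
  by apply: le_trans lr _; apply: ler_wpM2l => //; rewrite ltW.
have -> : s ^+ 2 * (x * z ^+ 2) = x * (s * z) ^+ 2 by ring.
have -> : s ^+ 2 * (3 / 2 * X * y) = 3 / 2 * (y * s * (s * X)) by field.
have h3 : 2 * (x * A ^+ 2) <= 3 * (y * s * lo).
  move: h; rewrite -[2 * x * _]mulrA -[3 * y * lo * s]mulrA -mulrA [lo * s]mulrC.
  by rewrite [y * (s * lo)]mulrA.
by move: h1 h2 h3; clear; lra.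
Qed.

Lemma C3_lt (a b : BinNums.N) K P : (1 < P)%N -> (0 < K)%N -> (0 <? b)%BN ->
  let m := (BinNat.N.of_nat P * BinNat.N.of_nat P.-1)%BN in
  (3 * b * (ratio_product_bounds P).2 * scale * (m + 1)
     <? 2 * a * zeta2_lower K ^ 2 * m)%BN ->
  C3 R < ofN a / ofN b.
Proof.
move=> P1 K0 /ofN_lt b0 m /ofN_lt.
rewrite !(ofN_mul, ofN_add) (ofN_exp _ 2) (ofN_of_nat 2) (ofN_of_nat 3) !ofN_of_nat ofN1.
have z0 : 0 < pi ^+ 2 / 6 :> R by rewrite divr_gt0 ?exprn_gt0 ?pi_gt0.
have zB := zeta2_lowerP K0; have /andP[_ ru] := ratio_product_boundsP P.
have /andP[_ Xr] := ratio_product_limit_bounds R P1.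
have s0 := scale_gt0; have r0 := ratio_product_gt0 R P; rewrite C3E.
have PE : P.-1%:R = P%:R - 1 :> R by rewrite -subn1 natrB // ltnW.
have P2 : 2 <= P%:R :> R by rewrite ler_nat.
have p0 : 0 < (P%:R - 1) * P%:R :> R by move: P2; clear => P2; apply: mulr_gt0; lra.
rewrite PE; move: Xr; rewrite [P%:R * _]mulrC.
move: ((P%:R - 1) * P%:R : R) p0 => q q0; clear PE P2.
move: (ofN_ge0 a) (ofN_ge0 (zeta2_lower K)) b0.
move: (ofN a) (ofN b) (ofN scale) (ofN (zeta2_lower K)) (ofN (ratio_product_bounds P).2)
  (pi ^+ 2 / 6) (ratio_product R P) (euler_limit R) z0 zB ru s0 r0
  => x y s B up z r D z0 zB ru s0 r0 x0 B0 y0; set X := z ^+ 3 * D => Xr h.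
have y0' : 0 < y := y0.
rewrite ltr_pdivlMr // mulrAC ltr_pdivrMr ?exprn_gt0 //.
have s2 : 0 < s ^+ 2 * q by rewrite mulr_gt0 // exprn_gt0.
rewrite -(ltr_pM2l s2).
have h1 : x * q * B ^+ 2 <= x * q * (s * z) ^+ 2.
  apply: ler_wpM2l; first by rewrite mulr_ge0 // ltW.
  by rewrite lerXn2r ?nnegrE // mulr_ge0 // ltW.
have h2 : y * s ^+ 2 * q * X <= y * s * (q + 1) * up.
  apply: (@le_trans _ _ (y * s ^+ 2 * q * (r * (1 + q^-1)))).
    by apply: ler_wpM2l => //; rewrite !mulr_ge0 ?sqr_ge0 // ltW.
  have -> : y * s ^+ 2 * q * (r * (1 + q^-1)) = y * s * (q + 1) * (s * r).
    by field; rewrite gt_eqF.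
  apply: ler_wpM2l => //; rewrite !mulr_ge0 ?ltW // addr_gt0 //.
have -> : s ^+ 2 * q * (x * z ^+ 2) = x * q * (s * z) ^+ 2 by ring.
have -> : s ^+ 2 * q * (3 / 2 * X * y) = 3 / 2 * (y * s ^+ 2 * q * X) by ring.
have h3 : 3 * (y * s * (q + 1) * up) < 2 * (x * q * B ^+ 2).
  have -> : 3 * (y * s * (q + 1) * up) = 3 * y * up * s * (q + 1) by ring.
  by have -> : 2 * (x * q * B ^+ 2) = 2 * x * B ^+ 2 * q by ring.
by move: h1 h2 h3; clear; lra.
Qed.

(** C3 = 0.70752092042..., so its distances to the two bounds are about 2e-8 and
    8e-8.  The primes below 3200 leave relative errors of at most 1e-7 above and
    about 1.2e-8 below, and 400 terms of zeta(2) leave less than 3e-9. *)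
Lemma C3_bounds :
  707 / 10 ^+ 3 + 520 / 10 ^+ 6 + 9 / 10 ^+ 7 <= C3 R < 707 / 10 ^+ 3 + 521 / 10 ^+ 6.
Proof.
have b0 k : 0 < 10 ^+ k :> R by rewrite exprn_gt0.
have ten k : ofN (10 ^ BinNat.N.of_nat k)%BN = 10 ^+ k.
  by rewrite ofN_exp (ofN_of_nat 10).
apply/andP; split.
  have := @C3_ge ((707 * 10 ^ 4 + 520 * 10) + 9)%BN (10 ^ 7)%BN 400 3200 isT isT.
  rewrite (ten 7) !ofN_add !ofN_mul (ten 4) (ten 1).
  rewrite (ofN_of_nat 707) (ofN_of_nat 520) (ofN_of_nat 9).
  have -> : (707 * 10 ^+ 4 + 520 * 10 ^+ 1 + 9) / 10 ^+ 7 =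
    707 / 10 ^+ 3 + 520 / 10 ^+ 6 + 9 / 10 ^+ 7 :> R by field.
  by apply; vm_compute.
have := @C3_lt (707 * 10 ^ 3 + 521)%BN (10 ^ 6)%BN 400 3200 isT isT isT.
rewrite (ten 6) !ofN_add !ofN_mul (ten 3) (ofN_of_nat 707) (ofN_of_nat 521).
have -> : (707 * 10 ^+ 3 + 521) / 10 ^+ 6 = 707 / 10 ^+ 3 + 521 / 10 ^+ 6 :> R by field.
by apply; vm_compute.
Qed.

End Numerics.

(** * The asymptotic formulas *)

Lemma subn_f23 (R : realType) n : n%:R - (f23 n)%:R = #|smaller_triples n|%:R :> R.
Proof. by rewrite -{1}(f23E n) natrD addrAC subrr add0r. Qed.

Lemma C3_gt0 (R : realType) : 0 < C3 R.
Proof.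
have /andP[h _] := @ratio_product_limit_bounds R 2 isT.
rewrite C3E; apply: divr_gt0.
  by apply: mulr_gt0; [rewrite divr_gt0|apply: lt_le_trans h; exact: ratio_product_gt0].
by rewrite exprn_gt0 // divr_gt0 // exprn_gt0 // pi_gt0.
Qed.

Lemma smaller_triples_equiv (R : realType) (e : R) : 0 < e ->
  \forall n \near \oo, `|#|smaller_triples n|%:R - C3 R * n%:R `^ (2 / 3)|
     <= e * (C3 R * n%:R `^ (2 / 3)).
Proof.
move=> e0; have c0 := C3_gt0 R.
have cE : C3 R = 3 / 2 * euler_limit R * (pi ^+ 2 / 6).
  by rewrite /C3 -/(euler_limit R); move: (pi ^+ 2 : R) => q; field.
have := smaller_triples_density (@basel R); rewrite -cE.
move=> /cvgrPdist_le/(_ (e * C3 R)); rewrite mulr_gt0 // => /(_ isT).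
apply: filterS => n; set p := n%:R `^ _; set t := _%:R => h.
have [p0|p0] := ltP 0 p; last first.
  have pz : p = 0 by apply/eqP; rewrite eq_le p0 powR_ge0.
  have : n%:R = 0 :> R by apply/eqP; move/eqP: pz; rewrite powR_eq0 => /andP[].
  move=> /eqP; rewrite pnatr_eq0 => /eqP n0.
  rewrite pz !mulr0 subr0 /t n0; have := f23E 0; case: #|_| => [|k]; last by lia.
  by rewrite normr0.
have -> : t - C3 R * p = (t / p - C3 R) * p by rewrite mulrBl divfK // gt_eqF.
rewrite normrM (gtr0_norm p0) mulrA ler_pM2r // distrC.
exact: h.
Qed.

Theorem corollary1p3 (R : realType) :
  [/\ (fun n : nat => n%:R - (F23 n)%:R : R) ~_\oo
        (fun n : nat => n%:R - (f23 n)%:R : R),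
      (fun n : nat => n%:R - (f23 n)%:R : R) ~_\oo
        (fun n : nat => C3 R * n%:R `^ (2 / 3) : R) &
      707 / 10 ^+ 3 + 520 / 10 ^+ 6 + 9 / 10 ^+ 7 <= C3 R
        < 707 / 10 ^+ 3 + 521 / 10 ^+ 6].
Proof.
have c0 := C3_gt0 R.
split; last exact: C3_bounds; apply/eqaddoP => e e0.
  have h2 : 0 < 2^-1 :> R by rewrite invr_gt0.
  have h := smaller_triples_equiv h2.
  pose M := 2 / (e * C3 R); have M0 : 0 < M by rewrite divr_gt0 // mulr_gt0.
  have big : \forall n \near \oo, M <= n%:R `^ (2 / 3) :> R.
    exists (Num.truncn (M ^+ 3)).+1 => // n /= Mn.
    have n0 : (0 < n)%N by apply: leq_trans Mn.
    have n1 : 1 <= n%:R :> R by rewrite ler1n.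
    rewrite leNgt; apply/negP => nM.
    have : n%:R ^+ 2 < M ^+ 3.
      have -> : n%:R ^+ 2 = (n%:R `^ (2 / 3)) ^+ 3 :> R.
        by rewrite -!powR_mulrn ?powR_ge0 // -powRrM; congr (_ `^ _); field.
      by rewrite ltrXn2r // ?nnegrE ?powR_ge0 // ltW.
    apply/negP; rewrite -leNgt; apply: (@le_trans _ _ n%:R).
      by apply: le_trans (ltW (truncnS_gt _)) _; rewrite ler_nat.
    by rewrite expr2 ler_peMl.
  near=> n.
  have hn : `|#|smaller_triples n|%:R - C3 R * n%:R `^ (2 / 3)|
     <= 2^-1 * (C3 R * n%:R `^ (2 / 3)) by near: n.
  have Mn : M <= n%:R `^ (2 / 3) by near: n.
  have -> : ((fun n : nat => n%:R - (F23 n)%:R : R) - (fun n => n%:R - (f23 n)%:R)) n =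
     (f23 n)%:R - (F23 n)%:R.
    change (n%:R - (F23 n)%:R - (n%:R - (f23 n)%:R) = (f23 n)%:R - (F23 n)%:R :> R).
    by ring.
  rewrite subn_f23 (ger0_norm (ler0n _ _)).
  have dF : `|(f23 n)%:R - (F23 n)%:R| <= 1 :> R.
    have h1 : (f23 n)%:R <= (F23 n)%:R :> R by rewrite ler_nat f23_leF.
    have h3 : (F23 n)%:R <= (f23 n)%:R + 1 :> R by rewrite natr1 ler_nat F23_le.
    by rewrite ler_norml; apply/andP; split; lra.
  apply: le_trans dF _.
  move: hn; rewrite ler_norml => /andP[hn _].
  have ht : 2^-1 * (C3 R * n%:R `^ (2 / 3)) <= #|smaller_triples n|%:R :> R by lra.
  apply: le_trans (ler_wpM2l (ltW e0) ht).
  have := ler_wpM2l (ltW (mulr_gt0 e0 c0)) Mn.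
  rewrite /M mulrC divfK; last by rewrite gt_eqF // mulr_gt0.
  by move=> h3; rewrite mulrCA mulrA; lra.
have := smaller_triples_equiv e0; apply: filterS => n.
have -> : ((fun n : nat => n%:R - (f23 n)%:R : R) - (fun n => C3 R * n%:R `^ (2 / 3))) n =
  #|smaller_triples n|%:R - C3 R * n%:R `^ (2 / 3).
  by rewrite -subn_f23.
by rewrite (ger0_norm (_ : 0 <= C3 R * n%:R `^ (2 / 3))) // mulr_ge0 ?powR_ge0 // ltW.
Unshelve. all: by end_near.
Qed.
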